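(* Let $A$ and $B$ be two unital Banach algebras, let $A\overline{\otimes}B$ be a Banach algebra that is the completion of the algebraic tensor product $A\otimes B$ with respect to a uniform crossnorm, and consider $a\in A$ and $b\in B$ such that $\sigma_{DR}(a)\neq\emptyset$ and $\sigma_{DR}(b)\neq\emptyset$. Set $\mathbb{D}=\sigma(a)\sigma_{DR}(b)\cup\sigma_{DR}(a)\sigma(b)$. Then the following statements are equivalent. (i) $\mathbb{D}=\sigma_{DR}(a\otimes b)$. (ii) Both $a\in A$ and $b\in B$ are invertible, or $a\otimes b$ is not Drazin invertible. (iii) Both $a\in A$ and $b\in B$ are invertible, or $0\notin(\Pi(a)\cap\rho_{DR}(b))\cup(\rho_{DR}(a)\cap\Pi(b))$.
   Context: Banach algebras are complex. A norm on $A\otimes B$ is a crossnorm if $\|x\otimes y\|=\|x\|\,\|y\|$ for $x\in A$, $y\in B$; it is uniform if $\|(U\otimes V)z\|\le\|U\|\,\|V\|\,\|z\|$ for all bounded linear maps $U$ on $A$, $V$ on $B$ and all $z\in A\otimes B$. The element $a\otimes b$ is regarded as an element of the Banach algebra $A\overline{\otimes}B$. For $K,L\subseteq\mathbb{C}$, $KL=\{kl: k\in K,\ l\in L\}$ (empty if $K$ or $L$ is empty). An element $x$ of a unital Banach algebra $C$ is Drazin invertible if there exist $y\in C$ and $m\in\mathbb{N}$ (with $m\ge0$ allowed) such that $x^myx=x^m$, $yxy=y$ and $xy=yx$. The Drazin spectrum of $x$ is $\sigma_{DR}(x)=\{\lambda\in\mathbb{C}: x-\lambda\text{ is not Drazin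 invertible in }C\}$, and $\rho_{DR}(x)=\mathbb{C}\setminus\sigma_{DR}(x)$. $\sigma(x)$ is the usual spectrum and $\mathrm{iso}\,\sigma(x)$ is the set of its isolated points. $\Pi(x)\subseteq\mathrm{iso}\,\sigma(x)$ is the set of poles of $x$: those $\lambda_0\in\mathrm{iso}\,\sigma(x)$ that are poles of some finite order $p\ge1$ of the resolvent function $R(\cdot,x)$, i.e. in the Laurent expansion $R(\lambda,x)=\sum_{n\ge0}a_n(\lambda-\lambda_0)^n+\sum_{n\ge1}b_n(\lambda-\lambda_0)^{-n}$ around $\lambda_0$ one has $b_p\ne0$ and $b_m=0$ for all $m\ge p+1$. *)

(* Defs.v *)
From HB Require Import structures.
From mathcomp Require Import all_boot all_order all_algebra.
From mathcomp Require Import all_classical all_reals all_analysis.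
From mathcomp Require Import sesquilinear complex.

Set Implicit Arguments.
Unset Strict Implicit.
Unset Printing Implicit Defensive.

Import Order.TTheory GRing.Theory Num.Theory.
Import numFieldNormedType.Exports.

Local Open Scope classical_set_scope.
Local Open Scope ring_scope.

(* The hierarchy of the library has no join of rings with normed modules other
   than number domains (where the norm is multiplicative).  Hence a Banach
   algebra is a record over a Banach space, and its carrier receives both the
   normed module structure and the algebra structure.  The norm of the
   unit is not required to be 1. *)
Record banachAlgType (K : numFieldType) := BanachAlg {
  banach_space : completeNormedModType K;
  banach_one : banach_space;
  banach_mul : banach_space -> banach_space -> banach_space;
  banach_mulA : associative banach_mul;
  banach_mul1l : left_id banach_one banach_mul;
  banach_mul1r : right_id banach_one banach_mul;
  banach_mulDl : left_distributive banach_mul +%R;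
  banach_mulDr : right_distributive banach_mul +%R;
  banach_one_neq0 : banach_one != 0;
  banach_scaleAl : forall k x y,
    k *: banach_mul x y = banach_mul (k *: x) y;
  banach_scaleAr : forall k x y,
    k *: banach_mul x y = banach_mul x (k *: y);
  banach_norm_mul_le : forall x y, `|banach_mul x y| <= `|x| * `|y|
}.

Definition banach_sort (K : numFieldType) (A : banachAlgType K) : Type :=
  banach_space A.
Coercion banach_sort : banachAlgType >-> Sortclass.

Section BanachAlgebraInstances.
Variables (K : numFieldType) (A : banachAlgType K).

HB.instance Definition _ := CompleteNormedModule.copy A (banach_space A).

HB.instance Definition _ := GRing.Zmodule_isNzRing.Build A
  (@banach_mulA K A) (@banach_mul1l K A) (@banach_mul1r K A)
  (@banach_mulDl K A) (@banach_mulDr K A) (@banach_one_neq0 K A).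

HB.instance Definition _ :=
  GRing.Lmodule_isLalgebra.Build K A (@banach_scaleAl K A).

HB.instance Definition _ :=
  GRing.Lalgebra_isAlgebra.Build K A (@banach_scaleAr K A).

Definition banach_inverse_of (x y : A) : Prop := y * x = 1 /\ x * y = 1.

Definition banach_unit : pred A :=
  fun x => `[< exists y, banach_inverse_of x y >].

Definition banach_inv (x : A) : A := xget x [set y | banach_inverse_of x y].

Lemma banach_invP x : banach_unit x -> banach_inverse_of x (banach_inv x).
Proof. by move=> /asboolP[y xy]; rewrite /banach_inv; case: xgetP => // /(_ y). Qed.

Lemma banach_mulVx : {in banach_unit, left_inverse 1 banach_inv *%R}.
Proof. by move=> x /banach_invP[]. Qed.

Lemma banach_mulxV : {in banach_unit, right_inverse 1 banach_inv *%R}.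
Proof. by move=> x /banach_invP[]. Qed.

Lemma banach_unitP x y : y * x = 1 /\ x * y = 1 -> banach_unit x.
Proof. by move=> xy; apply/asboolP; exists y. Qed.

Lemma banach_inv_out : {in [predC banach_unit], banach_inv =1 id}.
Proof.
move=> x; rewrite inE /= => /asboolPn xN.
by rewrite /banach_inv; case: xgetP => // y _ xy; case: xN; exists y.
Qed.

HB.instance Definition _ := GRing.NzRing_hasMulInverse.Build A
  banach_mulVx banach_mulxV banach_unitP banach_inv_out.

Lemma banach_normrM_le (x y : A) : `|x * y| <= `|x| * `|y|.
Proof. exact: banach_norm_mul_le. Qed.

End BanachAlgebraInstances.

Section Drazin.
Variables (K : numFieldType) (C : banachAlgType K).
Implicit Types (x : C) (l : K).

Definition drazin_invertible x : Prop :=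
  exists (y : C) (m : nat),
    [/\ x ^+ m * y * x = x ^+ m, y * x * y = y & x * y = y * x].

Definition spectrum x : set K := [set l | x - l%:A \isn't a GRing.unit].

Definition drazin_spectrum x : set K :=
  [set l | ~ drazin_invertible (x - l%:A)].

Definition drazin_resolvent_set x : set K := ~` drazin_spectrum x.

Definition resolvent x l : C := (l%:A - x)^-1.

(* b 0 plays no role: the principal part is indexed from 1. *)
Definition laurent_expansion (f : K -> C) l0 (a b : nat -> C) : Prop :=
  \forall l \near l0^', exists u v : C,
    [/\ series (fun n => (l - l0) ^+ n *: a n) @ \oo --> u,
        series (fun n => (l - l0) ^- n.+1 *: b n.+1) @ \oo --> v
      & f l = u + v].

Definition pole_of_order (f : K -> C) l0 (p : nat) : Prop :=
  exists a b : nat -> C,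
    [/\ laurent_expansion f l0 a b, b p != 0
      & forall m, (p < m)%N -> b m = 0].

Definition poles x : set K :=
  [set l0 | isolated (spectrum x) l0 /\
            exists2 p, (0 < p)%N & pole_of_order (resolvent x) l0 p].

End Drazin.

Definition set_mul (K : numFieldType) (S L : set K) : set K :=
  [set k * l | k in S & l in L].

(* T, together with the map t = (x, y) |-> x (x) y, is an algebraic tensor
   product of A and B. *)
Definition is_tensor_product (K : fieldType) (A B T : lmodType K)
    (t : {bilinear A -> B -> T}) : Prop :=
  forall (W : lmodType K) (f : {bilinear A -> B -> W}),
    exists2 g : {linear T -> W},
      forall x y, g (t x y) = f x y &
      forall g' : {linear T -> W},
        (forall x y, g' (t x y) = f x y) -> g' =1 g.

Section TensorNorm.
Variable R : realType.

Definition bounded_linear (V W : normedModType R[i]) (U : {linear V -> W}) :=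
  exists M : R[i], forall x, `|U x| <= M * `|x|.

(* Norms over R[i] are R[i]-valued (with zero imaginary part). *)
Definition opnorm (V W : normedModType R[i]) (U : {linear V -> W}) : R :=
  sup [set complex.Re `|U x| | x in [set x : V | `|x| <= 1]].

Variables (A B T : normedModType R[i]) (t : {bilinear A -> B -> T}).

Definition crossnorm : Prop := forall x y, `|t x y| = `|x| * `|y|.

(* When T is a tensor product of A and B, UV can only be U (x) V, and it
   exists for all U and V. *)
Definition uniform_norm : Prop :=
  forall (U : {linear A -> A}) (V : {linear B -> B}) (UV : {linear T -> T}),
    bounded_linear U -> bounded_linear V ->
    (forall x y, UV (t x y) = t (U x) (V y)) ->
    forall z, `|UV z| <= (opnorm U)%:C%C * (opnorm V)%:C%C * `|z|.

Definition is_completion (C : completeNormedModType R[i])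
    (iota : {linear T -> C}) : Prop :=
  (forall z, `|iota z| = `|z|) /\ dense (range iota).

End TensorNorm.

(* Main.v *)
From HB Require Import structures.
Require Import Defs.
From mathcomp Require Import all_boot all_order all_algebra.
From mathcomp Require Import all_classical all_reals all_analysis.
From mathcomp Require Import sesquilinear complex ring lra.
Import Order.TTheory GRing.Theory Num.Theory.
Import numFieldNormedType.Exports.
Local Open Scope classical_set_scope.
Local Open Scope ring_scope.

Set Implicit Arguments.
Unset Strict Implicit.
Unset Printing Implicit Defensive.

(** Idea. Write D for the set of the theorem.

    [0] lies in D exactly when [a] and [b] are not both invertible, so the
    equivalence of (i) and (ii) reduces to the equality of D and the Drazin
    spectrum of [a (x) b] away from [0].

    The Drazin spectrum is contained in D: put [z = x y - l] with [x = a (x) 1],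
    [y = 1 (x) b].  In the bicommutant S of [x] and [y], the [s] such that
    [s z^n] lies in [z^(n+1) S] for some [n] form an ideal, which is proper when
    [z] is not Drazin invertible.  Two applications of the Gelfand-Mazur theorem
    give [k], [k'] such that [x - k] and [y - k'] still generate a proper ideal
    with it; then [k k' = l], and if both [x - k] and [y - k'] were Drazin
    invertible, their spectral idempotents would put [1] in that ideal.

    D minus [0] is contained in the Drazin spectrum: if [l] is a boundary point of
    the spectrum of [b], approximate eigenvectors and the bimodule maps
    [id (x) phi] (bounded because the crossnorm is uniform) transfer the Drazin
    inverse of [a (x) b - k l] to bounded approximate inverses of [a - k], which
    converge to a Drazin inverse after taking powers.  Otherwise the pair can be
    moved along [(k / t, t l)] until it leaves the bounded spectrum of [b].

    Finally [0] is a pole of [a] iff [a] is Drazin invertible and not invertible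
    (comparison of Laurent coefficients), and [a (x) b] is Drazin invertible iff
    [a] and [b] are, neither being nilpotent. *)

(** No ideal in the argument is known to be closed, so quotients are never treated as Banach
    algebras. What replaces closedness is that the subalgebra S contains the inverses of its units:
    elements of a proper ideal of S then stay at distance at least 1 from [1], so the quotient
    seminorm of [1] does not vanish. This is enough for the Gelfand-Mazur theorem, whose proof by
    averages over roots of unity avoids contour integrals. Slices produce approximate left and right
    inverses separately, with no commutation between them and [a - k]. Drazin invertibility is
    therefore recognized by a pair of one-sided equations, [c ^+ m.+1 * g = c ^+ m] and
    [h * c ^+ m.+1 = c ^+ m]. Slicing [a (x) b - k l] at an approximate eigenvector of [b] for [l]
    leaves [l (a - k)], which is why [l] must be nonzero and 0 is treated apart. Since the norm of
    the unit is arbitrary, it enters many constants. *)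

Section RealNorm.
Variable R : realType.
Implicit Types (V : normedModType R[i]) (k : R[i]).

(** Norms take values in [R[i]]; the real part brings them to the totally ordered field [R], where
    [lra] and suprema apply. *)
Definition rnorm V (x : V) : R := complex.Re `|x|.

Lemma rnormE V (x : V) : `|x| = (rnorm x)%:C%C.
Proof. by rewrite /rnorm RRe_real ?normr_real. Qed.

Lemma rnorm_ge0 V (x : V) : 0 <= rnorm x.
Proof. by rewrite -(@lecR R) -rnormE normr_ge0. Qed.

Lemma rnorm0 V : rnorm (0 : V) = 0.
Proof. by rewrite /rnorm normr0. Qed.

Lemma rnorm_eq0 V (x : V) : rnorm x = 0 -> x = 0.
Proof. by move=> x0; apply/normr0_eq0; rewrite rnormE x0. Qed.

Lemma rnorm_gt0 V (x : V) : x != 0 -> 0 < rnorm x.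
Proof.
move=> x0; rewrite lt_neqAle rnorm_ge0 andbT eq_sym.
by apply: contra_neq x0 => /rnorm_eq0.
Qed.

Lemma rnormN V (x : V) : rnorm (- x) = rnorm x.
Proof. by rewrite /rnorm normrN. Qed.

Lemma rnormB V (x y : V) : rnorm (x - y) = rnorm (y - x).
Proof. by rewrite /rnorm distrC. Qed.

Lemma ler_rnormD V (x y : V) : rnorm (x + y) <= rnorm x + rnorm y.
Proof. by rewrite -lecR rmorphD /= -!rnormE ler_normD. Qed.

Lemma ler_rnormB V (x y : V) : rnorm (x - y) <= rnorm x + rnorm y.
Proof. by rewrite (le_trans (ler_rnormD _ _))// rnormN. Qed.

Definition cnorm k : R := complex.Re `|k|.

Lemma cnormE k : `|k| = (cnorm k)%:C%C.
Proof. by rewrite /cnorm RRe_real ?normr_real. Qed.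

Lemma cnorm_ge0 k : 0 <= cnorm k.
Proof. by rewrite -(@lecR R) -cnormE normr_ge0. Qed.

Lemma cnorm0 : cnorm 0 = 0.
Proof. by rewrite /cnorm normr0. Qed.

Lemma cnorm1 : cnorm 1 = 1.
Proof. by rewrite /cnorm normr1. Qed.

Lemma cnorm_eq0 k : cnorm k = 0 -> k = 0.
Proof. by move=> k0; apply/normr0_eq0; rewrite cnormE k0. Qed.

Lemma cnorm_gt0 k : k != 0 -> 0 < cnorm k.
Proof.
move=> k0; rewrite lt_neqAle cnorm_ge0 andbT eq_sym.
by apply: contra_neq k0 => /cnorm_eq0.
Qed.

Lemma cnormN k : cnorm (- k) = cnorm k.
Proof. by rewrite /cnorm normrN. Qed.

Lemma ler_cnormD k l : cnorm (k + l) <= cnorm k + cnorm l.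
Proof. by rewrite -lecR rmorphD /= -!cnormE ler_normD. Qed.

Lemma cnormM k l : cnorm (k * l) = cnorm k * cnorm l.
Proof. by rewrite /cnorm normrM !cnormE -rmorphM. Qed.

Lemma cnormV k : cnorm k^-1 = (cnorm k)^-1.
Proof. by rewrite /cnorm normfV cnormE -fmorphV. Qed.

Lemma cnormX k n : cnorm (k ^+ n) = cnorm k ^+ n.
Proof. by elim: n => [|n IH]; rewrite ?expr0 ?cnorm1// !exprS cnormM IH. Qed.

Lemma cnormR (r : R) : cnorm r%:C%C = `|r|.
Proof. by rewrite /cnorm normc_def /= expr0n addr0 sqrtr_sqr. Qed.

Lemma rnormZ V k (x : V) : rnorm (k *: x) = cnorm k * rnorm x.
Proof. by rewrite /rnorm normrZ rnormE cnormE -rmorphM. Qed.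

Lemma rnorm_trans V (y x z : V) (e f : R) :
  rnorm (x - y) <= e -> rnorm (y - z) <= f -> rnorm (x - z) <= e + f.
Proof.
move=> xy yz; rewrite -(subrKA y); apply: le_trans (ler_rnormD _ _) _.
exact: lerD.
Qed.

Lemma rnorm_small V (x : V) : (forall e, 0 < e -> rnorm x <= e) -> x = 0.
Proof.
move=> xe; apply: rnorm_eq0; apply/le_anti; rewrite rnorm_ge0 andbT.
by apply/ler_addgt0Pl => e e0; rewrite addr0 xe.
Qed.

Lemma rcvgP V (u : nat -> V) (l : V) :
  u @ \oo --> l <->
  forall e, 0 < e -> exists N, forall n, (N <= n)%N -> rnorm (u n - l) <= e.
Proof.
split=> [/cvgrPdist_le ul e e0|ul].
  have eC : 0 < e%:C%C :> R[i] by rewrite ltcR.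
  have [N _ ulN] := ul _ eC.
  by exists N => n Nn; rewrite -lecR -rnormE distrC; exact: ulN.
apply/cvgrPdist_le => /= e e0.
have e0' : 0 < complex.Re e by case: e e0 => a b; rewrite ltcE => /andP[].
have [N ulN] := ul _ e0'; exists N => //= n Nn.
rewrite distrC rnormE; apply: le_trans (_ : _ <= (complex.Re e)%:C%C) _.
  by rewrite lecR; exact: ulN.
by rewrite RRe_real// gtr0_real.
Qed.

Lemma rcauchy_cvg (V : completeNormedModType R[i]) (u : nat -> V) :
  (forall e, 0 < e -> exists N, forall n m, (N <= n)%N -> (N <= m)%N ->
     rnorm (u n - u m) <= e) ->
  exists l, forall e, 0 < e ->
    exists N, forall n, (N <= n)%N -> rnorm (u n - l) <= e.
Proof.
move=> uc; exists (lim (u @ \oo)); apply/rcvgP; apply: cauchy_cvg.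
apply: cauchy_exP => e e0.
have e0' : 0 < complex.Re e by case: e e0 => a b; rewrite ltcE => /andP[].
have [N uN] := uc _ (divr_gt0 e0' (ltr0Sn _ 1)).
exists (u N), N => //= n /= Nn.
rewrite -ball_normE /= rnormE; apply: lt_le_trans (_ : _ < (complex.Re e)%:C%C) _.
  by rewrite ltcR; apply: le_lt_trans (uN _ _ _ Nn) _ => //; lra.
by rewrite RRe_real// gtr0_real.
Qed.

End RealNorm.

(** * Invertibility and spectra in Banach algebras *)

Lemma geometric_small (R : realType) (C r e : R) : 0 <= r -> r < 1 -> 0 < e ->
  exists N, forall n, (N <= n)%N -> C * r ^+ n <= e.
Proof.
move=> r0 r1 e0.
have rl1 : `|r| < 1 by rewrite ger0_norm.
have := @cvg_geometric R C r rl1; move/cvgrPdist_le => /(_ _ e0)[N _ gN].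
exists N => n Nn; have := gN _ Nn; rewrite sub0r normrN /=.
by apply: le_trans; rewrite ler_norm.
Qed.

Section BanachAlgebra.
Variables (R : realType) (A : banachAlgType R[i]).
Implicit Types (x y z : A) (k l : R[i]) (e : R).

Lemma ler_rnormM x y : rnorm (x * y) <= rnorm x * rnorm y.
Proof. by rewrite -lecR rmorphM /= -!rnormE; exact: banach_normrM_le. Qed.

Lemma ler_rnormM2 x y (e f : R) :
  rnorm x <= e -> rnorm y <= f -> rnorm (x * y) <= e * f.
Proof.
move=> xe yf; apply: le_trans (ler_rnormM _ _) _.
by apply: ler_pM => //; exact: rnorm_ge0.
Qed.

Lemma rnorm_one_gt0 : 0 < rnorm (1 : A).
Proof. exact/rnorm_gt0/oner_neq0. Qed.

Lemma ler_rnormX x n : rnorm (x ^+ n) <= rnorm (1 : A) * rnorm x ^+ n.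
Proof.
elim: n => [|n IH]; first by rewrite !expr0 mulr1.
by rewrite !exprSr mulrA; exact: ler_rnormM2.
Qed.

Lemma eq_of_rnorm_small (x y : A) :
  (forall e, 0 < e -> rnorm (x - y) <= e) -> x = y.
Proof. by move=> /rnorm_small /eqP; rewrite subr_eq0 => /eqP. Qed.

Lemma unit_sub_small x : rnorm x < 1 -> 1 - x \is a GRing.unit.
Proof.
move=> x1; pose r := rnorm x; pose C := rnorm (1 : A).
have r0 : 0 <= r := rnorm_ge0 x.
have C0 : 0 < C := rnorm_one_gt0.
pose S (n : nat) := \sum_(i < n) x ^+ i.
(* The tail of the geometric series, multiplied through by [1 - r] so that the induction on [k]
   telescopes. *)
have Sd (m k : nat) : (1 - r) * rnorm (S (m + k)%N - S m) <= C * (r ^+ m - r ^+ (m + k)).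
  elim: k => [|k IH]; first by rewrite addn0 !subrr rnorm0 !mulr0.
  rewrite addnS /S big_ord_recr /= -/(S _) -addrAC.
  apply: le_trans (_ : _ <= (1 - r) * (rnorm (S (m + k)%N - S m) +
     C * r ^+ (m + k))) _.
    apply: ler_wpM2l; first by rewrite subr_ge0 ltW.
    by apply: le_trans (ler_rnormD _ _) _; rewrite lerD2l ler_rnormX.
  rewrite mulrDr; apply: le_trans (lerD IH (lexx _)) _.
  by rewrite exprS; set t := r ^+ (m + k); rewrite le_eqVlt; apply/orP; left;
     apply/eqP; ring.
have Sd2 m n : (m <= n)%N -> rnorm (S n - S m) <= C / (1 - r) * r ^+ m.
  move=> mn; have := Sd m (n - m)%N; rewrite subnKC// => h.
  rewrite mulrAC ler_pdivlMr ?subr_gt0// mulrC; apply: le_trans h _.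
  by rewrite ler_wpM2l ?(ltW C0)// gerBl exprn_ge0.
have [|s Ss] := @rcauchy_cvg R A S.
  move=> e e0; have [N Ne] := geometric_small (C / (1 - r)) r0 x1 e0.
  exists N => n m Nn Nm; case/orP: (leq_total m n) => mn.
    exact: le_trans (Sd2 _ _ mn) (Ne _ _).
  by rewrite rnormB; exact: le_trans (Sd2 _ _ mn) (Ne _ _).
have S1 n : (1 - x) * S n = 1 - x ^+ n.
  by apply: oppr_inj; rewrite -mulNr !opprB subrX1.
have S2 n : S n * (1 - x) = 1 - x ^+ n.
  rewrite -S1; apply: commr_sym; apply: commr_sum => i _.
  by apply: commrX; apply: commr_sym; apply: commrB; [exact: commr1|].
have x_small e : 0 < e -> exists N, forall n, (N <= n)%N -> rnorm (x ^+ n) <= e.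
  move=> e0; have [N Ne] := geometric_small C r0 x1 e0.
  by exists N => n Nn; exact: le_trans (ler_rnormX _ _) (Ne _ _).
(* [P] stands for multiplication by [1 - x] on either side, so one passage to the limit serves both
   products. *)
have lim1 (P : A -> A) : (forall u v, rnorm (P u - P v) <= rnorm (1 - x) * rnorm (u - v))
    -> (forall n, P (S n) = 1 - x ^+ n) -> P s = 1.
  move=> PL PS; apply: eq_of_rnorm_small => e e0.
  have d0 : 0 < rnorm (1 - x) + 1 by rewrite ltr_wpDl ?rnorm_ge0.
  have [N Nx] := x_small _ (divr_gt0 e0 (ltr0Sn R 1)).
  have [M Ms] := Ss _ (divr_gt0 (divr_gt0 e0 (ltr0Sn R 1)) d0).
  have := Ms (maxn N M) (leq_maxr _ _); have := Nx (maxn N M) (leq_maxl _ _).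
  set n := maxn N M => xn sn.
  rewrite [leRHS](splitr e); apply: (@rnorm_trans _ _ (P (S n))).
    apply: le_trans (PL _ _) _; rewrite (rnormB s).
    apply: le_trans (_ : _ <= (rnorm (1 - x) + 1) * rnorm (S n - s)) _.
      by rewrite ler_wpM2r ?rnorm_ge0// lerDl.
    by rewrite mulrC -ler_pdivlMr.
  by rewrite PS addrAC subrr sub0r rnormN.
apply/unitrP; exists s; split.
  apply: (lim1 ( *%R^~ (1 - x))) => // u v.
  by rewrite -mulrBl mulrC ler_rnormM.
by apply: (lim1 ( *%R (1 - x))) => // u v; rewrite -mulrBr ler_rnormM.
Qed.

Lemma unit_near x y : x \is a GRing.unit -> rnorm x^-1 * rnorm (x - y) < 1 ->
  y \is a GRing.unit.
Proof.
move=> ux xy; have -> : y = x * (1 - x^-1 * (x - y)).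
  by rewrite mulrBr mulr1 mulrA divrr// mul1r opprB addrC subrK.
by rewrite unitrMl// unit_sub_small// (le_lt_trans (ler_rnormM _ _)).
Qed.

Lemma algM k l : (k%:A : A) * l%:A = (k * l)%:A.
Proof. by rewrite -scalerAl mul1r scalerA. Qed.

Lemma alg_unit k : k != 0 -> (k%:A : A) \is a GRing.unit.
Proof.
move=> k0; apply/unitrP; exists (k^-1)%:A.
by rewrite !algM mulVf// mulfV// scale1r.
Qed.

Lemma spectrum_le x l : spectrum x l -> cnorm l <= rnorm x.
Proof.
move=> /negP xNu; rewrite leNgt; apply/negP => xl; apply: xNu.
have l0 : l != 0.
  by apply/eqP => l0; move: xl; rewrite l0 cnorm0 ltNge rnorm_ge0.
have -> : x - l%:A = - l%:A * (1 - l^-1 *: x).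
  by rewrite mulrBr mulr1 mulNr -scalerAr -scalerAl mul1r scalerA mulVf// scale1r
     opprK addrC.
rewrite unitrMl ?unitrN ?alg_unit// unit_sub_small// rnormZ cnormV.
by rewrite mulrC ltr_pdivrMr ?mul1r// cnorm_gt0.
Qed.

Lemma shift_sub x l m : (x - l%:A) - (x - m%:A) = (m - l)%:A.
Proof. by rewrite opprB addrC addrA subrK scalerBl. Qed.

Lemma spectrum_closed x l :
  (forall e, 0 < e -> exists2 m, spectrum x m & cnorm (m - l) < e) -> spectrum x l.
Proof.
move=> xl; apply/negP => ux.
have r0 : 0 < rnorm (x - l%:A)^-1 * rnorm (1 : A).
  rewrite mulr_gt0 ?rnorm_one_gt0// rnorm_gt0//.
  by apply: contraTneq ux => /(congr1 (fun z => z^-1)); rewrite invrK invr0 => ->;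
     rewrite unitr0.
have [|m xm ml] := xl (rnorm (x - l%:A)^-1 * rnorm (1 : A))^-1.
  by rewrite invr_gt0.
move/negP: xm; apply; apply: unit_near ux _.
rewrite shift_sub rnormZ mulrCA.
by rewrite -ltr_pdivlMr// div1r.
Qed.

(* Normalizing the resolvent at points approaching the boundary gives
   approximate eigenvectors that work on both sides at once. *)
Lemma boundary_eigenvector x l (e : R) : spectrum x l ->
  (forall d, 0 < d -> exists2 m, ~ spectrum x m & cnorm (m - l) < d) ->
  0 < e -> exists v : A, [/\ rnorm v = 1, rnorm ((x - l%:A) * v) <= e
    & rnorm (v * (x - l%:A)) <= e].
Proof.
move=> xl xb e0; pose C := rnorm (1 : A).
have C0 : 0 < C := rnorm_one_gt0.
(* With [r] the inverse of [x - m], the product [(x - l) r = 1 + (m - l) r] has norm at most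
   [C + |m - l| |r|]; by [dr] below the term [C] is at most [|m - l| C^2 |r|], whence
   [C * C + 1]. *)
have [|m xm ml] := xb (e / (C * C + 1)).
  by rewrite divr_gt0// addr_gt0// mulr_gt0.
move/negP/negPn: xm => um; pose r := (x - m%:A)^-1.
have r0 : 0 < rnorm r.
  apply: rnorm_gt0; apply: contraTneq um => /(congr1 (fun z => z^-1)).
  by rewrite invrK invr0 => ->; rewrite unitr0.
(* The resolvent is large near the spectrum: otherwise [unit_near] would carry invertibility from
   [x - m] over to [x - l]. *)
have dr : 1 <= cnorm (m - l) * C * rnorm r.
  rewrite leNgt; apply/negP => h; move: xl => /negP; apply.
  apply: unit_near um _; rewrite -/r shift_sub.
  by rewrite rnormZ mulrC -(opprB m) cnormN.
have key (w : A) : w = 1 + (m - l) *: r -> rnorm ((rnorm r)^-1%:C%C *: w) <= e.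
  move=> ->; rewrite rnormZ cnormR ger0_norm ?invr_ge0 ?rnorm_ge0//.
  rewrite mulrC ler_pdivrMr//; apply: le_trans (ler_rnormD _ _) _.
  rewrite -/C rnormZ; apply: le_trans (_ : _ <= cnorm (m - l) * (C * C + 1) * rnorm r) _.
    rewrite mulrDr mulr1 [leRHS]mulrDl lerD2r.
    by rewrite -[leLHS]mul1r mulrA [leRHS]mulrAC ler_wpM2r// ltW.
  by rewrite ler_wpM2r ?rnorm_ge0// -ler_pdivlMr ?ltW// addr_gt0// mulr_gt0.
have xlm : x - l%:A = (x - m%:A) + (m - l)%:A by rewrite scalerBl addrA subrK.
exists ((rnorm r)^-1%:C%C *: r); split.
- by rewrite rnormZ cnormR ger0_norm ?invr_ge0 ?rnorm_ge0// mulVf// gt_eqF.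
- rewrite -scalerAr; apply: key.
  by rewrite xlm mulrDl mulrV// -scalerAl mul1r.
- rewrite -scalerAl; apply: key.
  by rewrite xlm mulrDr mulVr// -scalerAr mulr1.
Qed.

End BanachAlgebra.

(** * Drazin inverses *)

Section DrazinAlgebra.
Variables (R : realType) (A : banachAlgType R[i]).
Implicit Types (c x y z : A).

Definition drazin_inverse x y m : Prop :=
  [/\ x ^+ m * y * x = x ^+ m, y * x * y = y & x * y = y * x].

(** The solutions [g] and [h] need neither agree nor commute with [c]. Iterating both equations
    gives [h ^+ m.+1 * c ^+ m = c ^+ m * g ^+ m.+1]; this common value is the Drazin inverse, and
    its two forms yield [c * y = c ^+ m * g ^+ m = h ^+ m * c ^+ m = y * c]. *)
Lemma drazin_two_sided c g h m :
  c ^+ m.+1 * g = c ^+ m -> h * c ^+ m.+1 = c ^+ m -> drazin_invertible c.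
Proof.
move=> cg hc.
have cgk k : c ^+ (m + k) * g ^+ k = c ^+ m.
  elim: k => [|k IH]; first by rewrite addn0 mulr1.
  rewrite addnS -addSn addnC exprD [g ^+ _]exprS mulrA -(mulrA (c ^+ k)) cg.
  by rewrite -exprD addnC.
have hck k : h ^+ k * c ^+ (m + k) = c ^+ m.
  elim: k => [|k IH]; first by rewrite addn0 mul1r.
  by rewrite addnS -addSn exprD exprSr mulrA -(mulrA (h ^+ k)) hc -mulrA -exprD.
pose y := h ^+ m.+1 * c ^+ m.
have yE : y = c ^+ m * g ^+ m.+1.
  by rewrite /y -{1}(cgk m.+1) mulrA hck.
have ycE : y * c = h ^+ m * c ^+ m.
  by rewrite /y -mulrA -exprSr exprSr -mulrA hc.
have cyE : c * y = c ^+ m * g ^+ m.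
  by rewrite yE mulrA -exprS [g ^+ _]exprS mulrA cg.
have cy : c * y = y * c.
  by rewrite cyE ycE -{1}(hck m) -mulrA cgk.
exists y, m; split=> //.
- rewrite -mulrA -cy mulrA -exprSr.
  have : GRing.comm y (c ^+ m.+1) by apply: commrX; rewrite /GRing.comm cy.
  rewrite /GRing.comm => <-; rewrite exprS mulrA ycE -mulrA -exprD.
  exact: hck.
- rewrite ycE -mulrA.
  have -> : c ^+ m * y = y * c ^+ m.
    by apply/esym/commrX; rewrite /GRing.comm cy.
  by rewrite {1}/y -mulrA -exprD mulrA -exprD addnC exprD -mulrA hck.
Qed.

Section Inverse.
Variables (x y : A) (m : nat).
Hypothesis xy : drazin_inverse x y m.
Let p := x * y.

Lemma drazin_idem : p * p = p.
Proof. by case: xy => _ yxy _; rewrite /p mulrA -(mulrA x) -(mulrA x) yxy. Qed.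

Lemma drazin_idemX : x ^+ m * (1 - p) = 0.
Proof. by case: xy => xm _ cxy; rewrite mulrBr mulr1 /p cxy mulrA xm subrr. Qed.

Lemma drazin_idemr : y * p = y.
Proof. by case: xy => _ yxy _; rewrite mulrA. Qed.

Lemma drazin_compx : GRing.comm p x.
Proof.
by case: xy => _ _ cxy; rewrite /GRing.comm /p -mulrA -cxy.
Qed.

Lemma drazin_compy : GRing.comm p y.
Proof.
by case: xy => _ _ cxy; rewrite /GRing.comm /p {1}cxy mulrA.
Qed.

(** The idempotent [p] is a multiple of [x ^+ m], while [x ^+ m] annihilates [1 - p]. Moving [w]
    across [x ^+ m] kills both off-diagonal corners of [w], so [w] commutes with [p]; on the corner
    of [p], [y] is the inverse of [x]. *)
Lemma drazin_comm w : GRing.comm w x -> GRing.comm w y.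
Proof.
move=> wx; have cxy : GRing.comm x y by case: xy.
have wxm : GRing.comm w (x ^+ m) by exact: commrX.
have pp := drazin_idem; have px := drazin_compx; have py := drazin_compy.
have pk k : x ^+ k * (y ^+ k * p) = p.
  elim: k => [|k IH]; first by rewrite !mul1r.
  rewrite exprSr exprS -mulrA (mulrA x) (mulrA x) -/p -(mulrA p).
  have -> : p * (y ^+ k * p) = y ^+ k * p.
    by rewrite mulrA (commrX k py) -mulrA pp.
  exact: IH.
have pmx : p * y ^+ m * x ^+ m = p.
  rewrite (commrX m py) -mulrA (commrX m px) mulrA -{2}(pk m).
  by rewrite [RHS]mulrA (commrX m (commr_sym (commrX m (commr_sym cxy)))).
have wp : (1 - p) * w * p = 0.
  rewrite -{2}(pk m) !mulrA -(mulrA (1 - p) w) wxm !mulrA.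
  have -> : (1 - p) * x ^+ m = x ^+ m * (1 - p).
    by rewrite mulrBl mulrBr mul1r mulr1 (commrX m px).
  by rewrite drazin_idemX !mul0r.
have pw : p * w * (1 - p) = 0.
  by rewrite -{1}pmx -!mulrA (mulrA (x ^+ m) w) -wxm -(mulrA w) drazin_idemX !mulr0.
have cwp : w * p = p * w.
  move/eqP: wp; rewrite mulrBl mul1r mulrBl subr_eq0 => /eqP ->.
  by move/eqP: pw; rewrite mulrBr mulr1 subr_eq0 => /eqP <-.
have yp := drazin_idemr.
rewrite /GRing.comm; have -> : w * y = p * w * y by rewrite -cwp -mulrA py yp.
by rewrite /p cxy -!mulrA (mulrA x) -wx -mulrA -/p cwp mulrA yp.
Qed.

(** The inverse splits along [p]: on its corner [x] is invertible with inverse [y], and on the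
    corner of [1 - p] it is nilpotent, so a finite geometric series suffices. Read as a function of
    [z], [- G] is the Laurent expansion of the resolvent at 0. *)
Lemma drazin_shift_inverse (z : R[i]) (G := y * (1 - z *: y)^-1
    - \sum_(k < m) z ^- k.+1 *: (x ^+ k * (1 - p))) :
  z != 0 -> 1 - z *: y \is a GRing.unit ->
  (x - z%:A) * G = 1 /\ G * (x - z%:A) = 1.
Proof.
move=> z0 uy; have cxy : GRing.comm x y by case: xy.
have px := drazin_compx; have yp := drazin_idemr.
have zA (w : A) : z%:A * w = z *: w by rewrite -scalerAl mul1r.
suff GL : (x - z%:A) * G = 1.
  split=> //; rewrite -[RHS]GL; apply: commr_sym.
  have xz (w : A) : GRing.comm x w -> GRing.comm (x - z%:A) w.
    move=> xw; apply: commr_sym; apply: commrB; first exact: commr_sym.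
    exact/commr_sym/comm_alg.
  apply: xz; apply: commrB.
    apply: commrM => //; apply: commrV; apply: commrB; first exact: commr1.
    by rewrite /GRing.comm -scalerAr -scalerAl cxy.
  apply: commr_sum => k _; rewrite /GRing.comm -scalerAr -scalerAl; congr (_ *: _).
  apply: commrM; first by apply: commrX.
  by apply: commrB; [exact: commr1|exact: commr_sym].
have tel n : (x - z%:A) * (\sum_(k < n) z ^- k.+1 *: (x ^+ k * (1 - p)))
    = (z ^- n *: x ^+ n - 1) * (1 - p).
  elim: n => [|n IH]; first by rewrite big_ord0 mulr0 invr1 scale1r subrr mul0r.
  rewrite big_ord_recr /= mulrDr IH -scalerAr (mulrBl _ x) zA mulrA -exprS scalerBr.
  have zn : z ^- n.+1 * z = z ^- n by rewrite exprS invfM mulrAC mulVf// mul1r.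
  by rewrite scalerA zn !mulrBl !mul1r -!scalerAl addrC addrA subrK.
rewrite /G mulrBr tel (mulrBl (1 - p)) -scalerAl drazin_idemX scaler0 sub0r mul1r opprK.
rewrite mulrA mulrBl zA -/p.
have -> : p - z *: y = p * (1 - z *: y).
  by rewrite mulrBr mulr1 -scalerAr drazin_compy yp.
by rewrite -mulrA divrr// mulr1 addrC subrK.
Qed.

End Inverse.

Lemma drazin_punctured x : drazin_invertible x ->
  exists2 d : R, 0 < d & forall z : R[i], z != 0 -> cnorm z < d ->
    x - z%:A \is a GRing.unit.
Proof.
move=> [y [m xy]]; exists (rnorm y + 1)^-1.
  by rewrite invr_gt0 ltr_wpDl// rnorm_ge0.
move=> z z0 zd.
have uy : 1 - z *: y \is a GRing.unit.
  apply: unit_sub_small; rewrite rnormZ.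
  apply: le_lt_trans (_ : _ <= cnorm z * (rnorm y + 1)) _.
    by rewrite ler_wpM2l ?cnorm_ge0// lerDl.
  by rewrite -ltr_pdivlMr ?div1r// ltr_wpDl// rnorm_ge0.
have [GL GR] := drazin_shift_inverse xy z0 uy.
by apply/unitrP; eexists; split; [exact: GR|exact: GL].
Qed.

End DrazinAlgebra.

(** * Limits and bounded approximate Drazin inverses *)

Lemma invn_small (R : realType) (C e : R) : 0 < e ->
  exists N : nat, forall n, (N <= n)%N -> C * n.+1%:R^-1 <= e.
Proof.
move=> e0; exists (Num.Def.archi_bound `|C / e|) => n Nn.
rewrite ler_pdivrMr ?ltr0n// mulrC -ler_pdivrMr//.
apply: le_trans (_ : _ <= `|C / e|) _; first exact: ler_norm.
apply: ltW; apply: lt_le_trans (archi_boundP _) _ => //.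
by rewrite ler_nat (leq_trans Nn).
Qed.

Section Tends.
Variables (R : realType) (A : banachAlgType R[i]).
Implicit Types (u : nat -> A) (l a : A).

Definition tends u l := forall e : R, 0 < e ->
  exists N, forall n, (N <= n)%N -> rnorm (u n - l) <= e.

Lemma tends_unique u l l' : tends u l -> tends u l' -> l = l'.
Proof.
move=> ul ul'; apply: eq_of_rnorm_small => e e0.
have e20 : 0 < e / 2 by rewrite divr_gt0.
have [N NP] := ul _ e20; have [N' NP'] := ul' _ e20.
rewrite (splitr e); apply: (@rnorm_trans _ _ (u (maxn N N'))).
  by rewrite rnormB; apply: NP; exact: leq_maxl.
by apply: NP'; exact: leq_maxr.
Qed.

Lemma tends_lipschitz (P : A -> A) (D : R) u l : 0 <= D ->
  (forall x y, rnorm (P x - P y) <= D * rnorm (x - y)) ->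
  tends u l -> tends (P \o u) (P l).
Proof.
move=> D0 PD ul e e0; have d0 : 0 < D + 1 by rewrite ltr_wpDl.
have [N NP] := ul _ (divr_gt0 e0 d0); exists N => n Nn.
apply: le_trans (PD _ _) _.
apply: le_trans (_ : _ <= (D + 1) * rnorm (u n - l)) _.
  by rewrite ler_wpM2r ?rnorm_ge0// lerDl.
by rewrite mulrC -ler_pdivlMr//; exact: NP.
Qed.

Lemma tends_mull a u l : tends u l -> tends (fun n => a * u n) (a * l).
Proof.
apply: (@tends_lipschitz ( *%R a) (rnorm a)) => [|x y]; first exact: rnorm_ge0.
by rewrite -mulrBr ler_rnormM.
Qed.

Lemma tends_mulr a u l : tends u l -> tends (fun n => u n * a) (l * a).
Proof.
apply: (@tends_lipschitz ( *%R^~ a) (rnorm a)) => [|x y]; first exact: rnorm_ge0.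
by rewrite -mulrBl mulrC ler_rnormM.
Qed.

Lemma tends_invn (C : R) u l :
  (forall n, rnorm (u n - l) <= C * n.+1%:R^-1) -> tends u l.
Proof.
move=> uC e e0; have [N NP] := invn_small C e0.
by exists N => n Nn; apply: le_trans (uC n) (NP _ _).
Qed.

End Tends.

Section BoundedApproximation.
Variables (R : realType) (A : banachAlgType R[i]) (c : A) (m : nat) (M : R).
Hypothesis M0 : 0 <= M.

Lemma ler_rnormX_bound (z : A) k : rnorm z <= M ->
  rnorm (z ^+ k) <= rnorm (1 : A) * M ^+ k.
Proof.
move=> zM; apply: le_trans (ler_rnormX _ _) _; rewrite ler_wpM2l ?rnorm_ge0//.
by apply: lerXn2r; rewrite // nnegrE rnorm_ge0.
Qed.

(** The constant depends on the bound [M] but not on [z], so it survives along a whole sequence of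
    approximations. *)
Lemma approx_left_power k : exists2 K : R, 0 <= K & forall (z : A) (e : R),
  rnorm z <= M -> rnorm (z * c ^+ m.+1 - c ^+ m) <= e ->
  rnorm (z ^+ k * c ^+ (m + k) - c ^+ m) <= K * e.
Proof.
elim: k => [|k [K K0 IH]].
  by exists 0 => // z e _ _; rewrite mul1r addn0 subrr rnorm0 mul0r.
exists (rnorm (1 : A) * M ^+ k * rnorm (c ^+ k) + K).
  by rewrite addr_ge0// !mulr_ge0// ?rnorm_ge0// exprn_ge0.
move=> z e zM ze.
have -> : z ^+ k.+1 * c ^+ (m + k.+1) - c ^+ m =
    z ^+ k * (z * c ^+ m.+1 - c ^+ m) * c ^+ k + (z ^+ k * c ^+ (m + k) - c ^+ m).
  rewrite mulrBr mulrBl -(mulrA _ (c ^+ m)) -exprD addrA subrK; congr (_ - _).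
  by rewrite exprSr -!mulrA -exprD addSnnS.
apply: le_trans (ler_rnormD _ _) _; rewrite mulrDl lerD ?IH//.
rewrite mulrAC; apply: ler_rnormM2 => //; apply: ler_rnormM2 => //.
exact: ler_rnormX_bound.
Qed.

Lemma approx_right_power k : exists2 K : R, 0 <= K & forall (z : A) (e : R),
  rnorm z <= M -> rnorm (c ^+ m.+1 * z - c ^+ m) <= e ->
  rnorm (c ^+ (m + k) * z ^+ k - c ^+ m) <= K * e.
Proof.
elim: k => [|k [K K0 IH]].
  by exists 0 => // z e _ _; rewrite mulr1 addn0 subrr rnorm0 mul0r.
exists (rnorm (c ^+ k) * (rnorm (1 : A) * M ^+ k) + K).
  by rewrite addr_ge0// !mulr_ge0// ?rnorm_ge0// exprn_ge0.
move=> z e zM ze.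
have -> : c ^+ (m + k.+1) * z ^+ k.+1 - c ^+ m =
    c ^+ k * (c ^+ m.+1 * z - c ^+ m) * z ^+ k + (c ^+ (m + k) * z ^+ k - c ^+ m).
  rewrite mulrBr mulrBl -exprD (addnC k) addrA subrK; congr (_ - _).
  by rewrite [z ^+ _]exprS !mulrA -exprD addnC addSnnS.
apply: le_trans (ler_rnormD _ _) _; rewrite mulrDl lerD ?IH//.
rewrite mulrAC; apply: ler_rnormM2 => //; first exact: ler_rnormM2.
exact: ler_rnormX_bound.
Qed.

(** The approximations themselves need not converge. As in [drazin_two_sided], a left and a right
    one can be compared through [z ^+ j * c ^+ (m + j) * z' ^+ j]: the sequences [X] and [W] are
    close to each other at all large pairs of indices, hence both are Cauchy with one common
    limit. *)
Lemma bounded_approx_drazin :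
  (forall e : R, 0 < e -> exists z z' : A, [/\ rnorm z <= M, rnorm z' <= M,
     rnorm (z * c ^+ m.+1 - c ^+ m) <= e & rnorm (c ^+ m.+1 * z' - c ^+ m) <= e]) ->
  drazin_invertible c.
Proof.
move=> app.
have /choice[u uP] (n : nat) : exists zz : A * A,
    [/\ rnorm zz.1 <= M, rnorm zz.2 <= M,
     rnorm (zz.1 * c ^+ m.+1 - c ^+ m) <= n.+1%:R^-1
   & rnorm (c ^+ m.+1 * zz.2 - c ^+ m) <= n.+1%:R^-1].
  by have [|z [z' h]] := app n.+1%:R^-1; [rewrite invr_gt0|exists (z, z')].
(* The exponent [m.+1] makes the limit [g] satisfy [c ^+ m.+1 * g = c ^+ m = g * c ^+ m.+1]. *)
pose j := m.+1; pose X n := (u n).1 ^+ j * c ^+ m; pose W n := c ^+ m * (u n).2 ^+ j.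
have [K K0 KP] := approx_left_power j; have [K' K'0 KP'] := approx_right_power j.
pose B := rnorm (1 : A) * M ^+ j.
have B0 : 0 <= B by rewrite mulr_ge0 ?rnorm_ge0 ?exprn_ge0.
have uK n : rnorm ((u n).1 ^+ j * c ^+ (m + j) - c ^+ m) <= K * n.+1%:R^-1.
  by case: (uP n) => z1 _ z3 _; exact: KP.
have uK' n : rnorm (c ^+ (m + j) * (u n).2 ^+ j - c ^+ m) <= K' * n.+1%:R^-1.
  by case: (uP n) => _ z2 _ z4; exact: KP'.
have XW n l : rnorm (X n - W l) <= B * (K' * l.+1%:R^-1) + K * n.+1%:R^-1 * B.
  have [z1 _ _ _] := uP n; have [_ z2 _ _] := uP l.
  apply: (@rnorm_trans _ _ ((u n).1 ^+ j * c ^+ (m + j) * (u l).2 ^+ j)).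
    rewrite rnormB /X -mulrA -mulrBr; apply: ler_rnormM2; last exact: uK'.
    exact: ler_rnormX_bound.
  rewrite /W -mulrBl; apply: ler_rnormM2; first exact: uK.
  exact: ler_rnormX_bound.
pose L := B * K' + K * B.
have L0 : 0 <= L by rewrite addr_ge0// mulr_ge0.
have XWe (e : R) : 0 < e -> exists N, forall n l, (N <= n)%N -> (N <= l)%N ->
    rnorm (X n - W l) <= e.
  move=> e0; have e20 : 0 < e / 2 by rewrite divr_gt0.
  have [N NP] := invn_small (B * K') e20; have [N' NP'] := invn_small (K * B) e20.
  exists (maxn N N') => n l; rewrite !geq_max => /andP[_ N'n] /andP[Nl _].
  rewrite (splitr e); apply: le_trans (XW n l) _; apply: lerD.
    by rewrite mulrA NP.
  by rewrite mulrAC NP'.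
have [|g Xg] := @rcauchy_cvg R A X.
  move=> e e0; have [|N NP] := XWe (e / 2); first by rewrite divr_gt0.
  exists N => n l Nn Nl; rewrite (splitr e); apply: (@rnorm_trans _ _ (W N)).
    exact: NP.
  by rewrite rnormB; exact: NP.
have Wg : tends W g.
  move=> e e0; have e20 : 0 < e / 2 by rewrite divr_gt0.
  have [N NP] := XWe _ e20; have [N' NP'] := Xg _ e20.
  exists N => n Nn; rewrite (splitr e); apply: (@rnorm_trans _ _ (X (maxn N N'))).
    by rewrite rnormB; apply: NP => //; exact: leq_maxl.
  by apply: NP'; exact: leq_maxr.
apply: (@drazin_two_sided _ _ c g g m).
  apply: tends_unique (tends_mull (c ^+ j) Wg) _; apply: (@tends_invn _ _ K') => n.
  by rewrite mulrA -exprD addnC; exact: uK'.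
apply: tends_unique (tends_mulr (c ^+ j) Xg) _; apply: (@tends_invn _ _ K) => n.
by rewrite -mulrA -exprD; exact: uK.
Qed.

End BoundedApproximation.

(** * The Gelfand-Mazur theorem modulo an ideal *)

Lemma cnorm_ReIm (R : realType) (u v : R) : cnorm (u +i* v)%C <= `|u| + `|v|.
Proof.
have -> : (u +i* v)%C = u%:C%C + 'i%C * v%:C%C by simpc.
apply: le_trans (ler_cnormD _ _) _; rewrite cnormM !cnormR.
by rewrite /cnorm normc_def /= expr0n expr1n add0r sqrtr1 mul1r.
Qed.

Lemma cnorm_ge_Re (R : realType) (k : R[i]) : `|complex.Re k| <= cnorm k.
Proof.
case: k => u v; rewrite /cnorm normc_def /= -sqrtr_sqr ler_sqrt.
  by rewrite lerDl sqr_ge0.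
by rewrite addr_ge0 ?sqr_ge0.
Qed.

Lemma cnorm_ge_Im (R : realType) (k : R[i]) : `|complex.Im k| <= cnorm k.
Proof.
case: k => u v; rewrite /cnorm normc_def /= -sqrtr_sqr ler_sqrt.
  by rewrite lerDr sqr_ge0.
by rewrite addr_ge0 ?sqr_ge0.
Qed.

(** The disc lies in a compact square; monotonicity in the bound turns the local bounds into a
    single one. *)
Lemma disc_uniform_bound (R : realType) (P : R -> R[i] -> Prop) (rho : R) :
  (forall M M' k, M <= M' -> P M k -> P M' k) ->
  (forall k0, exists2 d : R, 0 < d &
     exists M, forall k, cnorm (k - k0) <= d -> P M k) ->
  exists2 M, 0 < M & forall k, cnorm k <= rho -> P M k.
Proof.
move=> Pmono Ploc; pose I := `[- rho, rho]%classic : set R.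
have cI : compact (I `*` I) by apply: compact_setX; exact: segment_compact.
have := (compact_near_coveringP (I `*` I)).1 cI R +oo%R
  (fun M p => P M (p.1 +i* p.2)%C) _.
case=> [|M0 [M0r PM]].
  move=> [u v] _ /=; have [d d0 [M PM]] := Ploc (u +i* v)%C.
  have d20 : 0 < d / 2 by rewrite divr_gt0.
  exists (ball u (d / 2) `*` ball v (d / 2), [set M' | M <= M']).
    split; first by exists (ball u (d / 2), ball v (d / 2)) => //=; split; exact: nbhsx_ballx.
    by apply: nbhs_pinfty_ge; rewrite num_real.
  move=> [[u' v'] M'] /= [[uu' vv'] MM']; apply: Pmono MM' _; apply: PM.
  have -> : (u' +i* v')%C - (u +i* v)%C = ((u' - u) +i* (v' - v))%C by simpc.
  apply: le_trans (cnorm_ReIm _ _) _; rewrite (splitr d); apply: lerD.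
    by rewrite distrC ltW.
  by rewrite distrC ltW.
exists (`|M0| + 1); first by rewrite ltr_wpDl.
move=> k krho; have := PM (`|M0| + 1); case: k krho => u v uvr /(_ _ (u, v)); apply.
  by rewrite (le_lt_trans (ler_norm M0))// ltrDl.
split; rewrite /I /= in_itv /= -ler_norml.
  exact: le_trans (cnorm_ge_Re (u +i* v)%C) uvr.
exact: le_trans (cnorm_ge_Im (u +i* v)%C) uvr.
Qed.

Section CommutativeSubalgebra.
Variables (R : realType) (A : banachAlgType R[i]).
Implicit Types (S J : set A) (a b x : A) (e : R).

(** Closedness is not asked for: Neumann series are summed in [A], and [full_inv] brings the
    inverses back into [S]. A nonunit is its own [^-1], so [full_inv] constrains units only. *)
Record full_subalgebra S : Prop := FullSubalgebra {
  full_one : S 1;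
  full_sub : forall a b, S a -> S b -> S (a - b);
  full_mul : forall a b, S a -> S b -> S (a * b);
  full_scale : forall (k : R[i]) a, S a -> S (k *: a);
  full_comm : forall a b, S a -> S b -> a * b = b * a;
  full_inv : forall a, S a -> S a^-1 }.

Record ideal_of S J : Prop := IdealOf {
  ideal_sub : forall a, J a -> S a;
  ideal0 : J 0;
  ideal_add : forall a b, J a -> J b -> J (a + b);
  ideal_mul : forall a b, S a -> J b -> J (a * b) }.

Lemma half_neumann a : rnorm a <= 2^-1 ->
  1 - a \is a GRing.unit /\ rnorm (1 - a)^-1 <= 2 * rnorm (1 : A).
Proof.
move=> a2; have ua : 1 - a \is a GRing.unit.
  by apply: unit_sub_small; apply: le_lt_trans a2 _; lra.
split=> //; set w := (1 - a)^-1.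
have wE : w = 1 + a * w.
  by apply/eqP; rewrite -subr_eq -{1}(mul1r w) -mulrBl mulrV.
have : rnorm w <= rnorm (1 : A) + 2^-1 * rnorm w.
  rewrite {1}wE; apply: le_trans (ler_rnormD _ _) _; rewrite lerD2l.
  exact: ler_rnormM2.
lra.
Qed.

Section Ideal.
Variables S J : set A.
Hypotheses (HS : full_subalgebra S) (HJ : ideal_of S J).

Let SB := full_sub HS. Let SM := full_mul HS. Let S1 := full_one HS.
Let SZ := full_scale HS. Let SC := full_comm HS. Let JD := ideal_add HJ.

Lemma full0 : S 0. Proof. by rewrite -(subrr 1); exact: SB. Qed.

Lemma full_opp a : S a -> S (- a).
Proof. by move=> Sa; rewrite -sub0r; apply: SB => //; exact: full0. Qed.

Lemma full_add a b : S a -> S b -> S (a + b).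
Proof. by move=> Sa Sb; rewrite -(opprK b); apply: SB => //; exact: full_opp. Qed.

Lemma full_exp a n : S a -> S (a ^+ n).
Proof. by move=> Sa; elim: n => [|n IH]; rewrite ?expr0// exprS; exact: SM. Qed.

Lemma ideal_mulr a b : J a -> S b -> J (a * b).
Proof.
move=> Ja Sb; rewrite SC//; first exact: (ideal_mul HJ).
exact: (ideal_sub HJ).
Qed.

Lemma ideal_scale (k : R[i]) a : J a -> J (k *: a).
Proof.
move=> Ja; rewrite -[a]mul1r scalerAl; apply: (ideal_mul HJ) => //.
exact: SZ.
Qed.

Lemma ideal_opp a : J a -> J (- a).
Proof. by move=> /(ideal_scale (-1)); rewrite scaleN1r. Qed.

Definition cong a b := J (a - b).

Lemma cong_refl a : cong a a.
Proof. by rewrite /cong subrr; exact: (ideal0 HJ). Qed.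

Lemma cong_sym a b : cong a b -> cong b a.
Proof. by move=> /ideal_opp; rewrite opprB. Qed.

Lemma cong_trans b a c : cong a b -> cong b c -> cong a c.
Proof. by move=> ab bc; have := JD ab bc; rewrite addrA subrK. Qed.

Lemma cong_add a b c d : cong a b -> cong c d -> cong (a + c) (b + d).
Proof. by move=> ab cd; have := JD ab cd; rewrite addrACA -opprD. Qed.

Lemma cong_scale (k : R[i]) a b : cong a b -> cong (k *: a) (k *: b).
Proof. by move=> /(ideal_scale k); rewrite scalerBr. Qed.

Lemma cong_opp a b : cong a b -> cong (- a) (- b).
Proof. by move=> /(cong_scale (-1)); rewrite !scaleN1r. Qed.

Lemma cong_mull c a b : S c -> cong a b -> cong (c * a) (c * b).
Proof. by move=> Sc /(ideal_mul HJ Sc); rewrite mulrBr. Qed.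

Lemma cong_mulr c a b : S c -> cong a b -> cong (a * c) (b * c).
Proof. by move=> Sc ab; have := ideal_mulr ab Sc; rewrite mulrBl. Qed.

Lemma cong_inv_unique a b c : S a -> S b -> S c ->
  cong (a * b) 1 -> cong (c * b) 1 -> cong a c.
Proof.
move=> Sa Sb Sc ab cb; apply: (@cong_trans (a * (c * b))).
  by apply: cong_sym; rewrite -{2}(mulr1 a); exact: cong_mull.
have -> : a * (c * b) = c * (a * b) by rewrite !mulrA (SC Sa Sc).
by rewrite -{2}(mulr1 c); exact: cong_mull.
Qed.

(* The seminorm of the quotient by J, kept as a relation to avoid taking infima. *)
Definition qbound a e := exists2 b, S b & cong a b /\ rnorm b <= e.

Lemma qbound_of a : S a -> qbound a (rnorm a).
Proof. by move=> Sa; exists a => //; split; [exact: cong_refl|]. Qed.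

Lemma qbound_cong a b e : cong a b -> qbound b e -> qbound a e.
Proof. by move=> ab [c Sc [bc ce]]; exists c => //; split=> //; exact: cong_trans bc. Qed.

Lemma qbound_le a e e' : e <= e' -> qbound a e -> qbound a e'.
Proof. by move=> ee [c Sc [ac ce]]; exists c => //; split=> //; exact: le_trans ee. Qed.

Lemma qbound_add a b e e' : qbound a e -> qbound b e' -> qbound (a + b) (e + e').
Proof.
move=> [c Sc [ac ce]] [d Sd [bd de]]; exists (c + d); first exact: full_add.
split; first exact: cong_add.
by apply: le_trans (ler_rnormD _ _) _; exact: lerD.
Qed.

Lemma qbound_scale (k : R[i]) a e : qbound a e -> qbound (k *: a) (cnorm k * e).
Proof.
move=> [c Sc [ac ce]]; exists (k *: c); first exact: SZ.
split; first exact: cong_scale.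
by rewrite rnormZ ler_wpM2l ?cnorm_ge0.
Qed.

Lemma qbound_opp a e : qbound a e -> qbound (- a) e.
Proof. by move=> /(qbound_scale (-1)); rewrite scaleN1r cnormN cnorm1 mul1r. Qed.

Lemma qbound_mul a b e e' : S a -> qbound a e -> qbound b e' -> qbound (a * b) (e * e').
Proof.
move=> Sa [c Sc [ac ce]] [d Sd [bd de]]; exists (c * d); first exact: SM.
split; last exact: ler_rnormM2.
by apply: (@cong_trans (a * d)); [exact: cong_mull|exact: cong_mulr].
Qed.

(** A representative of [1] of norm less than 1 would make [1 - b] an element of [J] that is
    invertible in [S]. *)
Lemma qbound_one e : ~ J 1 -> qbound 1 e -> 1 <= e.
Proof.
move=> J1 [b Sb [ob be]]; rewrite leNgt; apply/negP => e1; apply: J1.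
have ub : 1 - b \is a GRing.unit by apply: unit_sub_small; exact: le_lt_trans e1.
rewrite -(mulVr ub); apply: (ideal_mul HJ) => //.
by apply: (full_inv HS); exact: SB.
Qed.

Lemma qbound_inv a b : S a -> S b -> cong (a * (1 - b)) 1 -> qbound b 2^-1 ->
  qbound a (2 * rnorm (1 : A)).
Proof.
move=> Sa Sb ab [c Sc [bc c2]]; have [uc wc] := half_neumann c2.
have Sw : S (1 - c)^-1 by apply: (full_inv HS); exact: SB.
exists (1 - c)^-1 => //; split=> //.
apply: (@cong_inv_unique _ (1 - b)) => //; first exact: SB.
apply: (@cong_trans ((1 - c)^-1 * (1 - c))).
  by apply: cong_mull => //; apply: cong_add (cong_refl 1) (cong_opp bc).
by rewrite mulVr//; exact: cong_refl.
Qed.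

Lemma qbound_inv1 a b e : S a -> S b -> cong (a * (1 - b)) 1 -> qbound b e ->
  e <= 2^-1 -> qbound (a - 1) (e * (2 * rnorm (1 : A))).
Proof.
move=> Sa Sb ab be e2.
apply: (@qbound_cong _ (b * a)).
  by move: ab; rewrite /cong mulrBr mulr1 (SC Sa Sb) addrAC.
apply: qbound_mul => //; apply: qbound_inv ab _ => //.
exact: qbound_le be.
Qed.

Section QuotientResolvent.
Variables (x : A) (r : R[i] -> A).
Hypotheses (Sx : S x) (J1 : ~ J 1) (rS : forall k, S (r k)).
Hypothesis rP : forall k, cong (r k * (k%:A - x)) 1.

Let Sshift k : S (k%:A - x). Proof. by apply: SB => //; exact: SZ. Qed.

Lemma qresolvent_sub k l : cong (r k - r l) ((l - k) *: (r k * r l)).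
Proof.
have -> : (l - k) *: (r k * r l) = r k * (r l * (l%:A - x)) - r k * (k%:A - x) * r l.
  rewrite -(SC (Sshift l) (rS l)) mulrA -mulrBl -mulrBr opprB addrA subrK.
  by rewrite -scalerBl -scalerAr mulr1 -scalerAl.
apply: cong_add.
  by rewrite -{1}(mulr1 (r k)); apply: cong_mull => //; exact: cong_sym.
by apply: cong_opp; rewrite -{1}(mul1r (r l)); apply: cong_mulr => //; exact: cong_sym.
Qed.

(** Modulo [J], [r k] is [(1 - b)^-1 * r k0] with [b = (k0 - k) *: r k0]; the radius [(2 * D)^-1]
    keeps [b] below one half, where [qbound_inv] applies. *)
Lemma qresolvent_locally_bounded k0 : exists2 d : R, 0 < d &
  exists M : R, forall k, cnorm (k - k0) <= d -> qbound (r k) M.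
Proof.
pose D := rnorm (r k0) + 1.
have D0 : 0 < D by rewrite ltr_wpDl// rnorm_ge0.
exists (2 * D)^-1; first by rewrite invr_gt0 mulr_gt0.
exists (2 * rnorm (1 : A) * rnorm (r k0)) => k kd.
pose a := r k * (k0%:A - x).
have Sa : S a by exact: SM.
have ra : cong (r k) (a * r k0).
  rewrite /a -mulrA -(SC (rS k0) (Sshift k0)) -{1}(mulr1 (r k)).
  by apply: cong_mull => //; exact: cong_sym.
apply: qbound_cong ra _; apply: qbound_mul => //; last exact: qbound_of.
pose b := (k0 - k) *: r k0.
have Sb : S b by exact: SZ.
apply: (@qbound_inv _ b) => //.
  have -> : a * (1 - b) = r k * (k0%:A - x) - (k0 - k) *: (r k * (r k0 * (k0%:A - x))).
    by rewrite mulrBr mulr1 /b -scalerAr /a -mulrA (SC (Sshift k0) (rS k0)).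
  apply: (@cong_trans (r k * (k0%:A - x) - (k0 - k) *: (r k * 1))).
    apply: cong_add; first exact: cong_refl.
    by apply/cong_opp/cong_scale/cong_mull.
  have -> : r k * (k0%:A - x) - (k0 - k) *: (r k * 1) = r k * (k%:A - x).
    by rewrite mulr1 !mulrBr -!scalerAr !mulr1 scalerBl opprB addrC addrA subrK.
  exact: rP.
exists b => //; split; first exact: cong_refl.
rewrite rnormZ -cnormN opprB.
apply: le_trans (_ : _ <= (2 * D)^-1 * D) _.
  by apply: ler_pM => //; rewrite ?cnorm_ge0 ?rnorm_ge0// lerDl.
by rewrite invfM -mulrA mulVf ?mulr1// gt_eqF.
Qed.

Lemma qresolvent_bounded (rho : R) : exists2 M : R, 0 < M &
  forall k, cnorm k <= rho -> qbound (r k) M.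
Proof.
apply: (@disc_uniform_bound _ (fun M k => qbound (r k) M)).
  by move=> M M' k; exact: qbound_le.
exact: qresolvent_locally_bounded.
Qed.

Section Averages.
Variables (rho M : R).
Hypothesis M0 : 0 < M.
Hypothesis rM : forall k, cnorm k <= rho -> qbound (r k) M.

(* Averaging [k *: r k] over the [2 ^ n]-th roots of unity, the discrete
   substitute for a contour integral of the resolvent. *)
Lemma qresolvent_average n : exists g : R[i] -> A,
  [/\ forall k, S (g k),
      forall k, k != 0 -> cong (g k * (1 - (k^-1 *: x) ^+ (2 ^ n))) 1,
      forall k, cnorm k <= rho -> qbound (g k) (cnorm k * M)
    & forall k l, cnorm k <= rho -> cnorm l <= rho ->
        qbound (g k - g l) (cnorm (k - l) * (rho * (M * M) + M))].
Proof.
elim: n => [|n [g [gS gP gM gL]]].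
  exists (fun k => k *: r k); split.
  - by move=> k; exact: SZ.
  - move=> k k0; rewrite expr1 -scalerAl.
    have -> : k *: (r k * (1 - k^-1 *: x)) = r k * (k%:A - x).
      by rewrite scalerAr scalerBr scalerA mulfV// scale1r.
    exact: rP.
  - by move=> k krho; apply: qbound_scale; exact: rM.
  - move=> k l krho lrho.
    have -> : k *: r k - l *: r l = k *: (r k - r l) + (k - l) *: r l.
      by rewrite scalerBr scalerBl addrA subrK.
    rewrite mulrDr; apply: qbound_add; last by apply: qbound_scale; exact: rM.
    apply: (@qbound_le _ (cnorm k * (cnorm (l - k) * (M * M)))).
      rewrite -(cnormN (l - k)) opprB mulrCA ler_wpM2l ?cnorm_ge0//.
      by rewrite ler_wpM2r// mulr_ge0// ltW.
    apply: qbound_scale; apply: qbound_cong (qresolvent_sub k l) _.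
    apply: qbound_scale; apply: qbound_mul => //; exact: rM.
(* With [u = (x / k) ^ (2 ^ n)], rotating [k] by [z] changes [u] into [- u], and [1 / (1 - u^2)] is
   the mean of [1 / (1 - u)] and [1 / (1 + u)]. Since [z] has modulus 1, both estimates pass to the
   mean with unchanged constants. *)
pose z : R[i] := (2 ^ n).-root (- 1).
have zn : z ^+ (2 ^ n) = -1 by rewrite rootCK// expn_gt0.
have z1 : cnorm z = 1.
  apply/eqP; rewrite -(@pexpr_eq1 _ _ (2 ^ n)) ?expn_gt0 ?cnorm_ge0//.
  by rewrite -cnormX zn cnormN cnorm1.
have zk k : cnorm (z * k) = cnorm k by rewrite cnormM z1 mul1r.
have z0 : z != 0 by apply/eqP => z0; move: z1; rewrite z0 cnorm0 => /eqP; rewrite eq_sym oner_eq0.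
have half : cnorm (2^-1 : R[i]) = 2^-1.
  have -> : (2^-1 : R[i]) = (2^-1 : R)%:C%C by rewrite fmorphV rmorph_nat.
  by rewrite cnormR ger0_norm.
exists (fun k => 2^-1 *: (g k + g (z * k))); split.
- by move=> k; apply/SZ/full_add.
- move=> k k0; set u := (k^-1 *: x) ^+ (2 ^ n).
  have Su : S u by apply: full_exp; exact: SZ.
  have gk := gP k k0; have gzk := gP (z * k) (mulf_neq0 z0 k0).
  have zu : ((z * k)^-1 *: x) ^+ (2 ^ n) = - u.
    by rewrite invfM -scalerA [in LHS]exprZn exprVn zn invrN1 scaleN1r.
  rewrite zu opprK in gzk; rewrite -/u in gk.
  have -> : (k^-1 *: x) ^+ (2 ^ n.+1) = u * u by rewrite expnSr exprM expr2.
  have S1u : S (1 + u) by exact: full_add.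
  have S1u' : S (1 - u) by exact: SB.
  have -> : 2^-1 *: (g k + g (z * k)) * (1 - u * u)
      = 2^-1 *: (g k * (1 - u) * (1 + u) + g (z * k) * (1 + u) * (1 - u)).
    rewrite -scalerAl -!mulrA (SC S1u S1u') -mulrDl; congr (_ *: (_ * _)).
    by rewrite mulrDr mulr1 mulrBl mul1r addrA subrK.
  have one : (1 : A) = 2^-1 *: (1 * (1 + u) + 1 * (1 - u)).
    have two : (1 : A) + 1 = (2 : R[i]) *: 1 by rewrite scaler_nat mulr2n.
    by rewrite !mul1r addrACA subrr addr0 two scalerA mulVf ?scale1r// pnatr_eq0.
  by rewrite [X in cong _ X]one; apply: cong_scale; apply: cong_add; apply: cong_mulr.
- move=> k krho.
  have -> : cnorm k * M = cnorm (2^-1 : R[i]) * (cnorm k * M + cnorm (z * k) * M).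
    by rewrite half zk; lra.
  apply: qbound_scale; apply: qbound_add; first exact: gM.
  by apply: gM; rewrite zk.
- move=> k l krho lrho; rewrite -scalerBr opprD addrACA.
  set L := rho * (M * M) + M.
  have -> : cnorm (k - l) * L = cnorm (2^-1 : R[i]) *
      (cnorm (k - l) * L + cnorm (z * k - z * l) * L).
    by rewrite -mulrBr half zk; lra.
  apply: qbound_scale; apply: qbound_add; first exact: gL.
  by apply: gL; rewrite zk.
Qed.

End Averages.

Let pw (t : R) n := ((t%:C%C)^-1 *: x) ^+ n.
Let one := rnorm (1 : A).

Let Spw t n : S (pw t n). Proof. by apply: full_exp; exact: SZ. Qed.

(** A substitute for the spectral radius of [x] modulo [J] being at most [t]. *)
Let power_bounded t := exists D N, forall n, (N <= n)%N -> qbound (pw t (2 ^ n)) D.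

Let power_bounded_init t : 0 < t -> rnorm x <= t -> power_bounded t.
Proof.
move=> t0 xt; exists one, 0%N => n _; apply: qbound_le (qbound_of (Spw _ _)).
apply: le_trans (ler_rnormX _ _) _.
rewrite -[leRHS]mulr1 ler_wpM2l ?rnorm_ge0// exprn_ile1 ?rnorm_ge0//.
by rewrite rnormZ cnormV cnormR gtr0_norm// mulrC ler_pdivrMr// mul1r.
Qed.

Let power_small s t (e : R) : 0 < s -> s < t -> power_bounded s -> 0 < e ->
  exists N, forall n, (N <= n)%N -> qbound (pw t (2 ^ n)) e.
Proof.
move=> s0 st [D [N sD]] e0; have t0 : 0 < t by exact: lt_trans st.
have q0 : 0 <= s / t by rewrite divr_ge0// ltW.
have q1 : s / t < 1 by rewrite ltr_pdivrMr ?mul1r.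
have [N' qN] := geometric_small D q0 q1 e0.
exists (maxn N N') => n; rewrite geq_max => /andP[Nn N'n].
have -> : pw t (2 ^ n) = ((s / t)%:C%C ^+ (2 ^ n)) *: pw s (2 ^ n).
  rewrite /pw !exprZn scalerA -exprMn; congr ((_ ^+ _) *: _).
  rewrite fmorph_div /= mulrAC mulfV ?mul1r//.
  by apply/eqP => /(congr1 (@complex.Re R)) /= s00; rewrite s00 ltxx in s0.
apply: qbound_le (qbound_scale _ (sD _ Nn)).
rewrite cnormX cnormR ger0_norm// mulrC; apply: qN.
by apply: leq_trans N'n _; rewrite ltnW// ltn_expl.
Qed.

(** The averages [g] invert [1 - (x / k) ^ (2 ^ n)] and are Lipschitz uniformly in [n]. Wherever the
    powers of [x / t] are bounded, [g] is near 1 slightly above [t], hence by the Lipschitz bound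
    also slightly below, which bounds the powers there. Descending in steps of [d] reaches a point
    where [g] is near 1 and also small. *)
Lemma qresolvent_not_total : False.
Proof.
(* The descent starts at [t0 = rnorm x + 1] and evaluates [g] up to [t0 + d] with [d <= 1]. *)
pose rho := rnorm x + 2.
have rho0 : 0 <= rho by rewrite addr_ge0 ?rnorm_ge0.
have [M M0 rM] := qresolvent_bounded rho.
pose L := rho * (M * M) + M.
have L0 : 0 < L by rewrite ltr_wpDl// mulr_ge0// mulr_ge0 ?ltW.
have o0 : 0 < one := rnorm_one_gt0 A.
pose t0 := rnorm x + 1.
have t00 : 0 < t0 by rewrite ltr_wpDl ?rnorm_ge0.
have [K] : exists K : nat, forall n, (K <= n)%N ->
    (* One inequality yields the three bounds [8 d L <= 1], [8 d M <= 1] and [d <= 1]; taking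
       [d = t0 / K.+1] makes [K] steps end exactly at [d]. *)
    (t0 * (8 * L + 8 * M + 1)) * n.+1%:R^-1 <= 1 by exact: invn_small.
move=> /(_ K (leqnn _)); set d := t0 * K.+1%:R^-1 => Kd.
have d0 : 0 < d by rewrite divr_gt0// ltr0n.
have {}Kd : d * (8 * L + 8 * M + 1) <= 1 by rewrite mulrAC.
have dL : d * L * 8 <= 1.
  have h1 : 0 < d * L by rewrite mulr_gt0.
  have h2 : 0 < d * M by rewrite mulr_gt0.
  by move: Kd; lra.
have dM : d * M * 8 <= 1.
  have h1 : 0 < d * L by rewrite mulr_gt0.
  have h2 : 0 < d * M by rewrite mulr_gt0.
  by move: Kd; lra.
have d1 : d <= 1.
  have h1 : 0 < d * L by rewrite mulr_gt0.
  have h2 : 0 < d * M by rewrite mulr_gt0.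
  by move: Kd; lra.
have tC0 t : 0 < t -> (t%:C%C : R[i]) != 0.
  move=> t1; apply/eqP => /(congr1 (@complex.Re R)) /= t1E.
  by rewrite t1E ltxx in t1.
have tCrho t : 0 <= t -> t <= rho -> cnorm t%:C%C <= rho.
  by move=> t1 tr; rewrite cnormR ger0_norm.
(* The first bound is the threshold of [qbound_inv1]; the second turns its conclusion into [g] being
   within 1/4 of 1. *)
pose eta := Num.min (2^-1) ((8 * one)^-1).
have eta0 : 0 < eta by rewrite lt_min !invr_gt0 mulr_gt0// ltr0n.
have eta2 : eta <= 2^-1 by rewrite ge_min lexx.
have etao : eta * (2 * one) <= 4^-1.
  apply: le_trans (_ : _ <= (8 * one)^-1 * (2 * one)) _.
    by apply: ler_wpM2r; [rewrite mulr_ge0// ltW|rewrite ge_min lexx orbT].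
  by rewrite invfM mulrACA mulVf ?gt_eqF// mulr1; lra.
have near1 t : 0 < t -> t + d <= rho -> power_bounded t -> exists N, forall n, (N <= n)%N ->
   forall g : R[i] -> A, (forall k, S (g k)) ->
   (forall k, k != 0 -> cong (g k * (1 - (k^-1 *: x) ^+ (2 ^ n))) 1) ->
   qbound (g (t + d)%:C%C - 1) 4^-1.
  move=> t1 tr Qt; have [|N NP] := power_small (t := t + d) t1 _ Qt eta0.
    by rewrite ltrDl.
  exists N => n Nn g gS gP; apply: qbound_le etao _.
  by apply: qbound_inv1 (NP _ Nn) _ => //; apply: gP; rewrite tC0// addr_gt0.
(* Between [t + d] and [t - d] the average moves by at most [2 d L <= 1/4], so [g] at [t - d] is
   within 1/2 of 1. Its inverse [1 - a] modulo [J] is then bounded by [2 * one], independently of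
   [n]. *)
have step t : d < t -> t + d <= rho -> power_bounded t -> power_bounded (t - d).
  move=> dt tr Qt; have t1 : 0 < t by exact: lt_trans dt.
  have td : 0 < t - d by rewrite subr_gt0.
  have [N NP] := near1 t t1 tr Qt.
  exists (one + 2 * one), N => n Nn.
  have [g [gS gP gM gL]] := qresolvent_average M0 rM n.
  have g1 := NP n Nn g gS gP.
  set a := pw (t - d) (2 ^ n).
  have g2 : qbound (g (t - d)%:C%C - g (t + d)%:C%C) 4^-1.
    apply: qbound_le (gL _ _ _ _); last 2 first.
    - by apply: tCrho; [exact: ltW|lra].
    - by apply: tCrho; [lra|].
    rewrite -rmorphB /= cnormR.
    have -> : t - d - (t + d) = - (2 * d) by lra.
    rewrite normrN ger0_norm -/L; last by rewrite mulr_ge0// ltW.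
    lra.
  have g3 : qbound (1 - g (t - d)%:C%C) 2^-1.
    rewrite -opprB; apply: qbound_opp.
    have -> : (2^-1 : R) = 4^-1 + 4^-1 by lra.
    by rewrite -(subrKA (g (t + d)%:C%C)); exact: qbound_add.
  have Sa : S a by exact: Spw.
  have h : qbound (1 - a) (2 * one).
    apply: qbound_inv g3; [exact: SB|exact: SB|].
    have -> : 1 - (1 - g (t - d)%:C%C) = g (t - d)%:C%C by rewrite opprB addrC subrK.
    rewrite SC//; last exact: SB.
    by apply: gP; exact: tC0.
  have -> : a = 1 - (1 - a) by rewrite opprB addrC subrK.
  by apply: qbound_add; [exact: qbound_of|exact: qbound_opp].
have down k : (k <= K)%N -> power_bounded (t0 - k%:R * d).
  elim: k => [_|k IH kK].
    by rewrite mul0r subr0; apply: power_bounded_init => //; rewrite lerDl.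
  have -> : t0 - k.+1%:R * d = t0 - k%:R * d - d by rewrite -natr1; lra.
  have t0E : t0 = K.+1%:R * d by rewrite /d mulrCA mulfV ?mulr1// pnatr_eq0.
  apply: step; last by apply: IH; exact: ltnW.
    rewrite {1}t0E -mulrBl -[ltLHS]mul1r ltr_pM2r//.
    by rewrite ltrBrDr nat1r ltr_nat.
  have : 0 <= k%:R * d by rewrite mulr_ge0// ltW.
  by rewrite /rho /t0; lra.
have Qd : power_bounded d.
  have := down K (leqnn _).
  have -> : t0 - K%:R * d = d; last by [].
  have t0E : t0 = K.+1%:R * d by rewrite /d mulrCA mulfV ?mulr1// pnatr_eq0.
  by rewrite {1}t0E -natr1; lra.
have dr : d + d <= rho by rewrite /rho; have := rnorm_ge0 x; lra.
have [N NP] := near1 d d0 dr Qd.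
have [g [gS gP gM gL]] := qresolvent_average M0 rM N.
have g1 := NP N (leqnn _) g gS gP.
have g2 : qbound (g (d + d)%:C%C) ((d + d) * M).
  have -> : (d + d) * M = cnorm (d + d)%:C%C * M by rewrite cnormR ger0_norm// addr_ge0// ltW.
  by apply: gM; apply: tCrho => //; rewrite addr_ge0// ltW.
(* At [2 d] the average is within 1/4 of 1 and of size at most [2 d M <= 1/4], against the lower
   bound 1 for the seminorm of [1]. *)
have : qbound 1 ((d + d) * M + 4^-1).
  have -> : (1 : A) = g (d + d)%:C%C - (g (d + d)%:C%C - 1) by rewrite opprB addrC subrK.
  by apply: qbound_add => //; exact: qbound_opp.
move=> /(qbound_one J1); lra.
Qed.

End QuotientResolvent.

Lemma exists_qspectrum x : S x -> ~ J 1 ->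
  exists k : R[i], forall s, S s -> ~ cong (s * (k%:A - x)) 1.
Proof.
move=> Sx J1; apply: contrapT => /forallNP H.
have /choice[r rP] k : exists s, S s /\ cong (s * (k%:A - x)) 1.
  by apply: contrapT => /forallNP h; apply: (H k) => s Ss c; apply: (h s).
by apply: (@qresolvent_not_total x r) => // k; have [] := rP k.
Qed.

End Ideal.
End CommutativeSubalgebra.

(** * Drazin invertibility of products of commuting elements *)

Section ProductSpectrum.
Variables (R : realType) (A : banachAlgType R[i]).
Implicit Types (S J : set A) (a b s x y : A).

Definition adjoin S J a : set A :=
  [set c | exists j s, [/\ J j, S s & c = j + s * a]].

Section Adjoin.
Variables (S J : set A) (a : A).
Hypotheses (HS : full_subalgebra S) (HJ : ideal_of S J) (Sa : S a).

Lemma adjoin_ideal : ideal_of S (adjoin S J a).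
Proof.
split.
- move=> _ [j [s [Jj Ss ->]]]; apply: (full_add HS).
    exact: (ideal_sub HJ).
  exact: (full_mul HS).
- by exists 0, 0; split; rewrite ?mul0r ?addr0//; [exact: (ideal0 HJ)|exact: full0 HS].
- move=> _ _ [j [s [Jj Ss ->]]] [j' [s' [Jj' Ss' ->]]].
  exists (j + j'), (s + s'); split; last by rewrite mulrDl addrACA.
    exact: (ideal_add HJ).
  exact: (full_add HS).
- move=> b _ Sb [j [s [Jj Ss ->]]]; exists (b * j), (b * s); split.
  + exact: (ideal_mul HJ).
  + exact: (full_mul HS).
  + by rewrite mulrDr mulrA.
Qed.

Lemma adjoin_sub : J `<=` adjoin S J a.
Proof. by move=> j Jj; exists j, 0; split=> //; [exact: full0 HS|rewrite mul0r addr0]. Qed.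

Lemma adjoin_gen s : S s -> adjoin S J a (s * a).
Proof. by move=> Ss; exists 0, s; split=> //; [exact: (ideal0 HJ)|rewrite add0r]. Qed.

Lemma adjoin_proper : (forall s, S s -> ~ cong J (s * a) 1) -> ~ adjoin S J a 1.
Proof.
move=> H [j [s [Jj Ss sE]]]; apply: (H s Ss).
have -> : s * a = 1 - j by rewrite sE addrAC subrr add0r.
by rewrite /cong addrAC subrr sub0r; exact: (ideal_opp HS HJ).
Qed.

End Adjoin.

Lemma nilpotent_add a b u m n : GRing.comm a b -> a ^+ m * u = 0 -> b ^+ n * u = 0 ->
  (a + b) ^+ (m + n) * u = 0.
Proof.
move=> ab au bu; rewrite exprDn_comm// mulr_suml big1// => i _.
rewrite mulrnAl; have [ni|ni] := leqP n i.
  by rewrite -(subnK ni) exprD -!mulrA bu !mulr0 mul0rn.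
rewrite (commrX _ (commr_sym (commrX _ (commr_sym ab)))).
have mi : (m <= m + n - i)%N by rewrite -addnBA ?leq_addr// ltnW.
by rewrite -(subnK mi) exprD -!mulrA au !mulr0 mul0rn.
Qed.

Section DrazinIdeal.
Variables (S : set A) (x y : A) (l : R[i]).
Hypotheses (HS : full_subalgebra S) (Sx : S x) (Sy : S y).
Hypothesis Sdr : forall w w' m, S w -> drazin_inverse w w' m -> S w'.
Let z := x * y - l%:A.

Let Salg k : S k%:A.
Proof. by apply: (full_scale HS); exact: (full_one HS). Qed.

Let Sz : S z.
Proof. apply: (full_sub HS) => //; exact: (full_mul HS). Qed.

(** Equivalently, the sum of [z S] and the elements of [S] killed by some power of [z]: the
    condition says that [s - z * t] is such an element. *)
Definition drazin_ideal : set A := [set s | S s /\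
  exists n t, S t /\ s * z ^+ n = z ^+ n.+1 * t].

Let J := drazin_ideal.

Lemma drazin_ideal_ideal : ideal_of S J.
Proof.
have up s n t k : S t -> s * z ^+ n = z ^+ n.+1 * t ->
    s * z ^+ (n + k) = z ^+ (n + k).+1 * t.
  move=> St h; rewrite exprD mulrA h -mulrA.
  by rewrite (full_comm HS St (full_exp HS k Sz)) mulrA -exprD addSn.
split.
- by move=> a [].
- split; first exact: full0 HS.
  by exists 0%N, 0; split; [exact: full0 HS|rewrite mul0r mulr0].
- move=> a b [Sa [n [t [St at_]]]] [Sb [n' [t' [St' bt']]]].
  split; first exact: (full_add HS).
  exists (n + n')%N, (t + t'); split; first exact: (full_add HS).
  by rewrite mulrDl (up _ _ _ _ St at_) addnC (up _ _ _ _ St' bt') mulrDr.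
- move=> a b Sa [Sb [n [t [St bt]]]]; split; first exact: (full_mul HS).
  exists n, (a * t); split; first exact: (full_mul HS).
  by rewrite -mulrA bt mulrA (full_comm HS Sa (full_exp HS _ Sz)) mulrA.
Qed.

Let HJ := drazin_ideal_ideal.

Lemma drazin_ideal1 : J 1 -> drazin_invertible z.
Proof.
move=> [_ [n [t [St]]]]; rewrite mul1r => zt; apply: (@drazin_two_sided _ _ z t t n).
  by [].
by rewrite -(full_comm HS (full_exp HS _ Sz) St).
Qed.

Lemma drazin_mul_shift_in :
  (forall k k', spectrum x k -> spectrum y k' -> k * k' = l ->
     drazin_invertible (x - k%:A) /\ drazin_invertible (y - k'%:A)) ->
  drazin_invertible z.
Proof.
move=> H; apply: contrapT => zN.
have J1 : ~ J 1 by move=> /drazin_ideal1.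
have [k kP] := exists_qspectrum HS HJ Sx J1.
have Sxk : S (k%:A - x) by exact: (full_sub HS).
(* Choosing [k'] relative to the enlarged ideal makes [(k, k')] a joint spectral value: [z], [x - k]
   and [y - k'] all end up in the proper ideal [J2]. *)
pose J' := adjoin S J (k%:A - x).
have HJ' : ideal_of S J' by exact: adjoin_ideal.
have J'1 : ~ J' 1 by exact: adjoin_proper.
have [k' k'P] := exists_qspectrum HS HJ' Sy J'1.
have Syk : S (k'%:A - y) by exact: (full_sub HS).
pose J2 := adjoin S J' (k'%:A - y).
have HJ2 : ideal_of S J2 by exact: adjoin_ideal.
have J21 : ~ J2 1 by exact: adjoin_proper.
have Sinv (w : A) (h : R[i]) : S w -> w - h%:A \is a GRing.unit ->
    exists2 s, S s & s * (h%:A - w) = 1.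
  move=> Sw uw; exists (- (w - h%:A)^-1).
    by apply: (full_opp HS); apply: (full_inv HS); exact: (full_sub HS).
  by rewrite -(opprB w h%:A) mulrNN mulVr.
have xk : spectrum x k.
  apply/negP => /(Sinv _ _ Sx)[s Ss sE]; apply: (kP s Ss).
  by rewrite sE; exact: (cong_refl HJ).
have yk : spectrum y k'.
  apply/negP => /(Sinv _ _ Sy)[s Ss sE]; apply: (k'P s Ss).
  by rewrite sE; exact: (cong_refl HJ').
have J'J2 : J' `<=` J2 by exact: adjoin_sub.
have JJ' : J `<=` J' by exact: adjoin_sub.
have J2x s : S s -> J2 (s * (x - k%:A)).
  move=> Ss; rewrite -(opprB k%:A) mulrN; apply: (ideal_opp HS HJ2).
  by apply: J'J2; exact: adjoin_gen.
have J2y s : S s -> J2 (s * (y - k'%:A)).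
  move=> Ss; rewrite -(opprB k'%:A) mulrN; apply: (ideal_opp HS HJ2).
  exact: adjoin_gen.
have JJ2 s : J s -> J2 s.
  by move=> Js; apply/J'J2/JJ'.
(* The first three of these four elements lie in [J2], so a nonzero scalar [k * k' - l] would put
   [1] there. *)
have zE : z = y * (x - k%:A) + k *: (y - k'%:A) + (k * k' - l)%:A.
  rewrite /z mulrBr -scalerAr mulr1 scalerBr scalerA addrA subrK scalerBl.
  by rewrite addrA subrK (full_comm HS Sx Sy).
have Jz : J z.
  split=> //; exists 0%N, 1; split; first exact: (full_one HS).
  by rewrite expr0 expr1 !mulr1.
have kk' : k * k' = l.
  apply/eqP; rewrite -subr_eq0; apply/negP => /negP kl; apply: J21.
  have -> : (1 : A) = (k * k' - l)^-1 *: (k * k' - l)%:A.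
    by rewrite scalerA mulVf// scale1r.
  apply: (ideal_scale HS HJ2).
  have -> : (k * k' - l)%:A = z - (y * (x - k%:A) + k *: (y - k'%:A)).
    by rewrite zE addrAC subrr add0r.
  apply: (ideal_add HJ2); first exact: JJ2.
  apply: (ideal_opp HS HJ2); apply: (ideal_add HJ2); first exact: J2x.
  by rewrite -[_ - _]mul1r scalerAl; exact: J2y.
have [[x' [m xm]] [y' [n yn]]] := H k k' xk yk kk'.
have Sxk' : S (x - k%:A) by exact: (full_sub HS).
have Syk' : S (y - k'%:A) by exact: (full_sub HS).
have Sx' := Sdr Sxk' xm; have Sy' := Sdr Syk' yn.
pose p := (x - k%:A) * x'; pose q := (y - k'%:A) * y'.
have Sp : S p by exact: (full_mul HS). have Sq : S q by exact: (full_mul HS).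
have Sp1 : S (1 - p) by apply: (full_sub HS) => //; exact: (full_one HS).
have Sq1 : S (1 - q) by apply: (full_sub HS) => //; exact: (full_one HS).
have J2p : J2 p by rewrite /p (full_comm HS Sxk' Sx'); exact: J2x.
have J2q : J2 q by rewrite /q (full_comm HS Syk' Sy'); exact: J2y.
(* On this corner [x - k] and [y - k'] are nilpotent, hence so is [z]; the product lies in [J] with
   witness [t = 0]. *)
have J2pq : J2 ((1 - p) * (1 - q)).
  apply: JJ2; split; first exact: (full_mul HS).
  exists (m + n)%N, 0; split; first exact: full0 HS.
  rewrite mulr0 (full_comm HS (full_mul HS Sp1 Sq1) (full_exp HS _ Sz)).
  rewrite zE kk' subrr scale0r addr0; apply: nilpotent_add.
  - apply: (full_comm HS); first exact: (full_mul HS).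
    exact: (full_scale HS).
  - rewrite exprMn_comm; last exact: (full_comm HS).
    by rewrite -(mulrA (y ^+ m)) (mulrA ((x - k%:A) ^+ m)) (drazin_idemX xm) mul0r mulr0.
  - rewrite exprZn -scalerAl (full_comm HS Sp1 Sq1) mulrA (drazin_idemX yn).
    by rewrite mul0r scaler0.
apply: J21; have -> : (1 : A) = (1 - p) * (1 - q) + ((1 - p) * q + p).
  by rewrite addrA -mulrDr subrK mulr1 subrK.
apply: (ideal_add HJ2) => //; apply: (ideal_add HJ2) => //.
exact: (ideal_mul HJ2).
Qed.

End DrazinIdeal.

Section Bicommutant.
Variables x y : A.
Hypothesis xy : GRing.comm x y.

(** Commutative because [x] and [y] commute, and stable under inverses. By [drazin_comm] it also
    contains the Drazin inverses of its elements, as [drazin_mul_shift_in] requires. *)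
Definition bicommutant : set A :=
  [set s | forall w, GRing.comm w x -> GRing.comm w y -> GRing.comm w s].

Lemma bicommutant_full : full_subalgebra bicommutant.
Proof.
split.
- by move=> w _ _; exact: commr1.
- by move=> a b Sa Sb w wx wy; apply: commrB; [exact: Sa|exact: Sb].
- by move=> a b Sa Sb w wx wy; apply: commrM; [exact: Sa|exact: Sb].
- move=> k a Sa w wx wy; rewrite /GRing.comm -scalerAl -scalerAr.
  by congr (_ *: _); exact: Sa.
- move=> a b Sa Sb; apply: Sb.
    by apply: commr_sym; apply: Sa.
  by apply: commr_sym; apply: Sa.
- by move=> a Sa w wx wy; apply: commrV; exact: Sa.
Qed.

Lemma drazin_mul_shift (l : R[i]) :
  (forall k k', spectrum x k -> spectrum y k' -> k * k' = l ->
     drazin_invertible (x - k%:A) /\ drazin_invertible (y - k'%:A)) ->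
  drazin_invertible (x * y - l%:A).
Proof.
move=> H; apply: (drazin_mul_shift_in bicommutant_full _ _ _ H) => //.
move=> w w' m Sw ww' v vx vy.
by apply: (drazin_comm ww'); exact: Sw.
Qed.

End Bicommutant.
End ProductSpectrum.

(** * Slice maps and the lower inclusion *)

Section Slices.
Variables (R : realType) (A B C : banachAlgType R[i]).
Variables (al : A -> C) (be : B -> C).

Record algebra_hom (D : banachAlgType R[i]) (f : D -> C) : Prop := AlgebraHom {
  hom_add : forall x y, f (x + y) = f x + f y;
  hom_mul : forall x y, f (x * y) = f x * f y;
  hom_one : f 1 = 1;
  hom_scale : forall (k : R[i]) x, f (k *: x) = k *: f x }.

(** The model is the extension to the completion of [id (x) phi], for a functional [phi] of norm 1
    with [phi v = 1]. *)
Record is_slice (v : B) (E : C -> A) : Prop := IsSlice {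
  slice_add : forall X Y, E (X + Y) = E X + E Y;
  slice_scale : forall (k : R[i]) X, E (k *: X) = k *: E X;
  slice_le : forall X, rnorm (E X) <= rnorm X;
  slice_mull : forall x X, E (al x * X) = x * E X;
  slice_mulr : forall x X, E (X * al x) = E X * x;
  slice_one : E (be v) = 1 }.

End Slices.

Section HomLemmas.
Variables (R : realType) (D C : banachAlgType R[i]) (f : D -> C).
Hypothesis fh : algebra_hom f.

Lemma hom_opp x : f (- x) = - f x.
Proof. by rewrite -scaleN1r (hom_scale fh) scaleN1r. Qed.

Lemma hom_sub x y : f (x - y) = f x - f y.
Proof. by rewrite (hom_add fh) hom_opp. Qed.

Lemma hom_exp x n : f (x ^+ n) = f x ^+ n.
Proof.
by elim: n => [|n IH]; rewrite ?expr0 ?(hom_one fh)// !exprS (hom_mul fh) IH.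
Qed.

Lemma hom_alg k : f k%:A = k%:A.
Proof. by rewrite (hom_scale fh) (hom_one fh). Qed.

Lemma hom_drazin x : drazin_invertible x -> drazin_invertible (f x).
Proof.
move=> [y [m [h1 h2 h3]]]; exists (f y), m.
by split; rewrite -?hom_exp -?(hom_mul fh) ?h1 ?h2 ?h3.
Qed.

Lemma hom_unit x : x \is a GRing.unit -> f x \is a GRing.unit.
Proof.
by move=> ux; apply/unitrP; exists (f x^-1); rewrite -!(hom_mul fh) mulVr// mulrV// (hom_one fh).
Qed.

End HomLemmas.

Section DrazinPower.
Variables (R : realType) (C : banachAlgType R[i]) (z y : C) (m : nat).
Hypothesis zy : drazin_inverse z y m.

Lemma drazin_powl : y * z ^+ m.+1 = z ^+ m.
Proof.
case: zy => zm _ czy; rewrite -[RHS]zm -mulrA -czy mulrA -exprSr.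
by apply: commrX; apply: commr_sym.
Qed.

Lemma drazin_powr : z ^+ m.+1 * y = z ^+ m.
Proof. by case: zy => zm _ czy; rewrite -[RHS]zm -mulrA -czy mulrA -exprSr. Qed.

End DrazinPower.

Section PowerApproximation.
Variables (R : realType) (C : banachAlgType R[i]) (z w : C).
Hypothesis zw : GRing.comm z w.

Lemma power_approxl m : exists2 K : R, 0 <= K & forall (V : C) (e : R),
  rnorm (z * V - w * V) <= e -> rnorm (z ^+ m * V - w ^+ m * V) <= K * e.
Proof.
elim: m => [|m [K K0 IH]].
  by exists 0 => // V e _; rewrite subrr rnorm0 mul0r.
exists (rnorm z * K + rnorm (w ^+ m)); first by rewrite addr_ge0 ?mulr_ge0 ?rnorm_ge0.
move=> V e Ve.
have -> : z ^+ m.+1 * V - w ^+ m.+1 * V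
    = z * (z ^+ m * V - w ^+ m * V) + w ^+ m * (z * V - w * V).
  by rewrite !mulrBr !mulrA -exprS -exprSr (commrX m zw) addrA subrK.
apply: le_trans (ler_rnormD _ _) _; rewrite mulrDl -mulrA.
by apply: lerD; apply: ler_rnormM2 => //; exact: IH.
Qed.

Lemma power_approxr m : exists2 K : R, 0 <= K & forall (V : C) (e : R),
  rnorm (V * z - V * w) <= e -> rnorm (V * z ^+ m - V * w ^+ m) <= K * e.
Proof.
elim: m => [|m [K K0 IH]].
  by exists 0 => // V e _; rewrite subrr rnorm0 mul0r.
exists (K * rnorm z + rnorm (w ^+ m)); first by rewrite addr_ge0 ?mulr_ge0 ?rnorm_ge0.
move=> V e Ve.
have -> : V * z ^+ m.+1 - V * w ^+ m.+1
    = (V * z ^+ m - V * w ^+ m) * z + (V * z - V * w) * w ^+ m.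
  by rewrite !mulrBl -!mulrA -exprSr -exprS -(commrX m zw) addrA subrK.
apply: le_trans (ler_rnormD _ _) _; rewrite [leRHS]mulrDl.
apply: lerD; last by rewrite mulrC; exact: ler_rnormM2.
by rewrite mulrAC; apply: ler_rnormM2 => //; exact: IH.
Qed.

End PowerApproximation.

Section SliceDrazin.
Variables (R : realType) (A B C : banachAlgType R[i]).
Variables (al : A -> C) (be : B -> C) (N : R).
Hypotheses (alh : algebra_hom al) (beh : algebra_hom be).
Hypothesis ab_comm : forall x y, GRing.comm (al x) (be y).
Hypothesis be_le : forall y, rnorm (be y) <= N * rnorm y.
Hypothesis slices : forall v, rnorm v = 1 -> exists E, is_slice al be v E.

(** The difference [z - w] is [al a * be (b - l)], which is small against [V = be v] for an
    approximate eigenvector [v]. Thus [y * z ^+ m.+1 = z ^+ m] becomes an approximate identity for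
    [w] on [V], and slicing it gives one for [a - k]. *)
Lemma boundary_drazin (a : A) (b : B) (k l : R[i]) : l != 0 -> spectrum b l ->
  (forall d, 0 < d -> exists2 m, ~ spectrum b m & cnorm (m - l) < d) ->
  drazin_invertible (al a * be b - (k * l)%:A) -> drazin_invertible (a - k%:A).
Proof.
move=> l0 bl bb [y [m zy]].
set z := al a * be b - (k * l)%:A in zy.
pose c := a - k%:A; pose w := l *: al c.
have alc : al c = al a - k%:A by rewrite hom_sub// hom_alg.
have zc : GRing.comm z (al c).
  apply: commr_sym; rewrite alc /z; apply: commrB; last exact/commr_sym/comm_alg.
  apply: commrM; apply: commr_sym; apply: commrB.
  - exact: commr_refl.
  - exact/commr_sym/comm_alg.
  - exact/commr_sym.
  - exact/commr_sym/comm_alg.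
have zw : GRing.comm z w by rewrite /GRing.comm /w -scalerAl -scalerAr zc.
have [K1 K10 KP1] := power_approxl zw m.
have [K2 K20 KP2] := power_approxl zw m.+1.
have [K3 K30 KP3] := power_approxr zw m.
have [K4 K40 KP4] := power_approxr zw m.+1.
have N0 : 0 <= N.
  have := be_le 1; have := rnorm_one_gt0 B; have := rnorm_ge0 (be 1) => h1 h2 h3.
  by rewrite -(@pmulr_lge0 _ (rnorm (1 : B))) // (le_trans h1).
(* Collects the errors of the left and the right estimate, after division by [l ^+ m]; an
   approximate eigenvector of precision [e / (D + 1)] then gives error [e]. *)
pose D := cnorm l ^- m * (rnorm y * (K2 + K4) + (K1 + K3)) * (rnorm (al a) * N).
have D0 : 0 <= D.
  apply: mulr_ge0; last by rewrite mulr_ge0 ?rnorm_ge0.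
  apply: mulr_ge0; first by rewrite invr_ge0 exprn_ge0// cnorm_ge0.
  by apply: addr_ge0; rewrite ?mulr_ge0 ?rnorm_ge0// addr_ge0.
have M0 : 0 <= cnorm l * (rnorm y * N).
  by rewrite !mulr_ge0 ?rnorm_ge0 ?cnorm_ge0.
apply: (bounded_approx_drazin (c := c) (m := m) M0) => e e0; have [v [v1 bv vb]] := boundary_eigenvector bl bb
  (divr_gt0 e0 (ltr_wpDl D0 ltr01)).
set d := e / (D + 1) in bv vb.
have [E sE] := slices v1.
have Esub X Y : E (X - Y) = E X - E Y.
  by rewrite (slice_add sE) -(scaleN1r Y) (slice_scale sE) scaleN1r.
pose V := be v.
have V1 : rnorm V <= N by rewrite /V; have := be_le v; rewrite v1 mulr1.
have cV x : GRing.comm (al x) V by exact: ab_comm.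
have zE : z = w + al a * be (b - l%:A).
  rewrite (hom_sub beh) (hom_alg beh) mulrBr -scalerAr mulr1 /w alc scalerBr scalerA.
  by rewrite (mulrC l k) addrC addrA subrK.
have Vl : rnorm (z * V - w * V) <= rnorm (al a) * (N * d).
  rewrite -mulrBl zE addrAC subrr add0r -(mulrA (al a)) -(hom_mul beh).
  apply: ler_rnormM2 => //; apply: le_trans (be_le _) _.
  by rewrite ler_wpM2l.
have Vr : rnorm (V * z - V * w) <= rnorm (al a) * (N * d).
  rewrite -mulrBr zE addrAC subrr add0r (mulrA V) -cV -(mulrA (al a)) -(hom_mul beh).
  apply: ler_rnormM2 => //; apply: le_trans (be_le _) _.
  by rewrite ler_wpM2l.
have wX n : w ^+ n = l ^+ n *: al (c ^+ n) by rewrite /w exprZn hom_exp.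
pose K := rnorm y * (K2 + K4) + (K1 + K3).
have final (X Y : A) : l ^+ m *: X = Y -> rnorm Y <= K * (rnorm (al a) * (N * d)) ->
    rnorm X <= e.
  move=> <- h.
  have lm : 0 < cnorm l ^+ m by rewrite exprn_gt0// cnorm_gt0.
  rewrite rnormZ cnormX mulrC -ler_pdivlMr// in h; apply: le_trans h _.
  have -> : K * (rnorm (al a) * (N * d)) / cnorm l ^+ m = D * d.
    by rewrite /D -/K; ring.
  rewrite /d mulrCA ger_pMr// ler_pdivrMr ?mul1r ?lerDl//.
  exact: ltr_wpDl.
have d0 : 0 <= rnorm (al a) * (N * d).
  apply: mulr_ge0; first exact: rnorm_ge0.
  by apply: mulr_ge0 => //; rewrite ltW// divr_gt0// ltr_wpDl.
(* The bound on these witnesses does not depend on [e]. The bimodule property moves the powers of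
   [c] out of [E], and [E V = 1] leaves [c ^+ m]. *)
exists (l *: E (y * V)), (l *: E (V * y)); split.
- rewrite rnormZ ler_wpM2l ?cnorm_ge0//; apply: le_trans (slice_le sE _) _.
  exact: ler_rnormM2.
- rewrite rnormZ ler_wpM2l ?cnorm_ge0//; apply: le_trans (slice_le sE _) _.
  by rewrite mulrC; exact: ler_rnormM2.
- apply: (final _ (E (y * (w ^+ m.+1 * V) - w ^+ m * V))).
    rewrite Esub !wX -!scalerAl -scalerAr !(slice_scale sE) (cV (c ^+ m.+1)).
    rewrite (mulrA y) (slice_mulr sE) (slice_mull sE) (slice_one sE) mulr1.
    by rewrite scalerBr scalerA -exprSr.
  apply: le_trans (slice_le sE _) _.
  have -> : y * (w ^+ m.+1 * V) - w ^+ m * V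
      = - (y * (z ^+ m.+1 * V - w ^+ m.+1 * V)) + (z ^+ m * V - w ^+ m * V).
    by rewrite mulrBr opprB (mulrA y (z ^+ m.+1)) (drazin_powl zy) addrA subrK.
  rewrite /K; apply: le_trans (ler_rnormD _ _) _; rewrite rnormN.
  apply: le_trans (_ : _ <= (rnorm y * K2 + K1) * (rnorm (al a) * (N * d))) _.
    rewrite [leRHS]mulrDl -mulrA; apply: lerD; last exact: KP1.
    by apply: ler_rnormM2 => //; exact: KP2.
  rewrite ler_wpM2r//; apply: lerD; last by rewrite lerDl.
  by rewrite ler_wpM2l ?rnorm_ge0// lerDl.
- apply: (final _ (E (V * w ^+ m.+1 * y - V * w ^+ m))).
    rewrite Esub !wX -!scalerAr -scalerAl !(slice_scale sE) -!cV -mulrA.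
    rewrite !(slice_mull sE) (slice_one sE) mulr1.
    by rewrite scalerBr scalerA -exprSr.
  apply: le_trans (slice_le sE _) _.
  have -> : V * w ^+ m.+1 * y - V * w ^+ m
      = - ((V * z ^+ m.+1 - V * w ^+ m.+1) * y) + (V * z ^+ m - V * w ^+ m).
    by rewrite mulrBl opprB -(mulrA V (z ^+ m.+1)) (drazin_powr zy) addrA subrK.
  rewrite /K; apply: le_trans (ler_rnormD _ _) _; rewrite rnormN.
  apply: le_trans (_ : _ <= (rnorm y * K4 + K3) * (rnorm (al a) * (N * d))) _.
    rewrite [leRHS]mulrDl -mulrA; apply: lerD; last exact: KP3.
    by rewrite [leRHS]mulrC; apply: ler_rnormM2 => //; exact: KP4.
  rewrite ler_wpM2r//; apply: lerD; last by rewrite lerDr.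
  by rewrite ler_wpM2l ?rnorm_ge0// lerDr.
Qed.

End SliceDrazin.

(** * Drazin spectrum of a product away from zero *)

Section Accumulation.
Variables (R : realType) (A : banachAlgType R[i]).
Implicit Types (x : A) (k l : R[i]).

Lemma accumulation_drazin_spectrum x l :
  (forall d : R, 0 < d -> exists m, [/\ m != l, spectrum x m & cnorm (m - l) < d]) ->
  drazin_spectrum x l.
Proof.
move=> xl xD; have [d d0 dP] := drazin_punctured xD.
have [m [ml /negP xm md]] := xl d d0; apply: xm.
have := dP (m - l); rewrite subr_eq0 ml => /(_ isT md).
by rewrite scalerBl opprB addrA subrK.
Qed.

Lemma cnorm_real (r : R) : 0 <= r -> cnorm r%:C%C = r.
Proof. by move=> r0; rewrite cnormR ger0_norm. Qed.

Lemma interior_drazin_spectrum x l (d : R) : 0 < d ->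
  (forall m, cnorm (m - l) < d -> spectrum x m) ->
  drazin_spectrum x l.
Proof.
move=> d0 xl; apply: accumulation_drazin_spectrum => d' d'0.
pose r := Num.min d d' / 2.
have r0 : 0 < r by rewrite divr_gt0// lt_min d0.
have rd : r < d by rewrite /r ltr_pdivrMr// (@le_lt_trans _ _ d) ?ge_min ?lexx//; lra.
have rd' : r < d'.
  by rewrite /r ltr_pdivrMr// (@le_lt_trans _ _ d') ?ge_min ?lexx ?orbT//; lra.
have rE : l + r%:C%C - l = r%:C%C by rewrite addrAC subrr add0r.
exists (l + r%:C%C); rewrite rE cnorm_real ?ltW//; split=> //.
  rewrite -subr_eq0 rE; apply/eqP => /(congr1 (@complex.Re R)) /= rr.
  by rewrite rr ltxx in r0.
by apply: xl; rewrite rE cnorm_real ?ltW.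
Qed.

End Accumulation.

Section TensorSpectrum.
Variables (R : realType) (A B C : banachAlgType R[i]).
Variables (al : A -> C) (be : B -> C) (N : R).
Hypotheses (alh : algebra_hom al) (beh : algebra_hom be).
Hypothesis ab_comm : forall x y, GRing.comm (al x) (be y).
Hypothesis al_le : forall x, rnorm (al x) <= N * rnorm x.
Hypothesis be_le : forall y, rnorm (be y) <= N * rnorm y.
Hypothesis slicesA : forall v, rnorm v = 1 -> exists E, is_slice al be v E.
Hypothesis slicesB : forall v, rnorm v = 1 -> exists E, is_slice be al v E.
Variables (a : A) (b : B).

(** If [l] were a boundary point, [boundary_drazin] would contradict the choice of [k]. So [l] is
    interior, hence in the Drazin spectrum of [b], and the same argument with the factors exchanged
    applies to [k]. *)
Let opened k l : k * l != 0 -> drazin_spectrum a k -> spectrum b l ->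
  drazin_invertible (al a * be b - (k * l)%:A) ->
  exists d : R, [/\ 0 < d, (forall m, cnorm (m - k) < d -> spectrum a m)
   & forall m, cnorm (m - l) < d -> spectrum b m].
Proof.
rewrite mulf_eq0 negb_or => /andP[k0 l0] ak bl zD.
have interior (D : banachAlgType R[i]) (x : D) h :
    ~ (forall d : R, 0 < d -> exists2 m, ~ spectrum x m & cnorm (m - h) < d) ->
    exists2 d : R, 0 < d & forall m, cnorm (m - h) < d -> spectrum x m.
  move=> /existsNP[d /not_implyP[d0 dP]]; exists d => // m md.
  by apply: contrapT => xm; apply: dP; exists m.
have [d1 d10 dP1] : exists2 d : R, 0 < d & forall m, cnorm (m - l) < d -> spectrum b m.
  apply: interior => bb; apply: ak.
  exact: (boundary_drazin alh beh ab_comm be_le slicesA l0 bl bb zD).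
have bD := interior_drazin_spectrum d10 dP1.
have ak' : spectrum a k.
  apply/negP => u; apply: ak; exists (a - k%:A)^-1, 0%N.
  by rewrite !expr0 !mul1r mulVr// mulrV// mul1r.
have [d2 d20 dP2] : exists2 d : R, 0 < d & forall m, cnorm (m - k) < d -> spectrum a m.
  apply: interior => aa; apply: bD.
  apply: (boundary_drazin beh alh _ al_le slicesB k0 ak' aa).
    by move=> x y; exact/commr_sym.
  by rewrite -ab_comm (mulrC l).
exists (Num.min d1 d2); rewrite lt_min d10 d20; split=> // m; rewrite lt_min => /andP[m1 m2].
  exact: dP2.
exact: dP1.
Qed.

(** If the conclusion failed, the set of [t >= 1] with [Q t] would contain its supremum and, by
    [opened], a point beyond it. The supremum is finite because [l * t] stays in the spectrum of
    [b]. *)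
Lemma product_drazin_spectrum k l : k * l != 0 -> drazin_spectrum a k -> spectrum b l ->
  drazin_spectrum (al a * be b) (k * l).
Proof.
move=> kl ak bl zD.
have /andP[k0 l0] : (k != 0) && (l != 0) by rewrite -negb_or -mulf_eq0.
pose Q (t : R) := drazin_spectrum a (k / t%:C%C) /\ spectrum b (l * t%:C%C).
have tC0 (t : R) : 0 < t -> (t%:C%C : R[i]) != 0.
  move=> t1; apply/eqP => /(congr1 (@complex.Re R)) /= t1E.
  by rewrite t1E ltxx in t1.
have Qkl (t : R) : 0 < t -> k / t%:C%C * (l * t%:C%C) = k * l.
  by move=> t0; rewrite mulrACA mulVf ?tC0// mulr1.
have dist (t t' : R) : 1 <= t -> 1 <= t' ->
    cnorm (k / t'%:C%C - k / t%:C%C) <= cnorm k * `|t' - t|.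
  move=> t1 t'1; have t0 : 0 < t by lra. have t'0 : 0 < t' by lra.
  have -> : k / t'%:C%C - k / t%:C%C = k * ((t - t') / (t * t'))%:C%C.
    rewrite -mulrBr fmorph_div /= rmorphB rmorphM /=; congr (_ * _).
    by field; rewrite !tC0.
  rewrite cnormM ler_wpM2l ?cnorm_ge0// cnormR normrM (distrC t).
  rewrite ler_piMr ?normr_ge0// normfV gtr0_norm ?mulr_gt0// invf_le1 ?mulr_gt0//.
  by rewrite -[leLHS]mulr1 ler_pM.
have Qopen (t : R) : 1 <= t -> Q t -> exists2 t', t < t' & Q t'.
  move=> t1 [at_ bt]; have t0 : 0 < t by lra.
  have kl' : k / t%:C%C * (l * t%:C%C) != 0 by rewrite Qkl.
  have zD' : drazin_invertible (al a * be b - (k / t%:C%C * (l * t%:C%C))%:A).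
    by rewrite Qkl.
  have [d [d0 aI bI]] := opened kl' at_ bt zD'.
  pose D := cnorm k + cnorm l + 1.
  have D0 : 0 < D by have := cnorm_ge0 k; have := cnorm_ge0 l; rewrite /D; lra.
  pose e := d / D / 2.
  have e0 : 0 < e by rewrite !divr_gt0.
  have eD : e * D < d by rewrite /e mulrAC divfK ?gt_eqF// ltr_pdivrMr//; lra.
  have ek : e * cnorm k < d.
    by apply: le_lt_trans eD; rewrite ler_pM2l// /D; have := cnorm_ge0 l; lra.
  have el : e * cnorm l < d.
    by apply: le_lt_trans eD; rewrite ler_pM2l// /D; have := cnorm_ge0 k; lra.
  have kt : cnorm (k / (t + e)%:C%C - k / t%:C%C) < d.
    apply: le_lt_trans (dist _ _ _ _) _ => //; first lra.
    by rewrite addrAC subrr add0r gtr0_norm// mulrC.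
  exists (t + e); first by rewrite ltrDl.
  split; last first.
    apply: bI; rewrite -mulrBr -rmorphB /= addrAC subrr add0r cnormM.
    by rewrite cnorm_real ?ltW// mulrC.
  apply: (@interior_drazin_spectrum _ _ _ _ (d - cnorm (k / (t + e)%:C%C - k / t%:C%C))).
    by rewrite subr_gt0.
  move=> m md; apply: aI; rewrite -(subrKA (k / (t + e)%:C%C)).
  by apply: le_lt_trans (ler_cnormD _ _) _; rewrite -ltrBrDr.
pose E := [set t : R | 1 <= t /\ Q t].
have E1 : E 1 by split=> //; rewrite /Q divr1 mulr1.
have Eb : has_sup E.
  split; first by exists 1.
  exists (rnorm b / cnorm l) => t [t1 [_ /spectrum_le]].
  by rewrite cnormM cnorm_real ?(le_trans ler01)// ler_pdivlMr ?cnorm_gt0// mulrC.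
pose T := sup E.
have T1 : 1 <= T by exact: sup_upper_bound.
have T0 : 0 < T by lra.
have QT : Q T.
  (* If [T] is not attained, points of [E] tend to it strictly from below, so [k / T] is approached
     by spectral values different from it, as accumulation requires. *)
  have [[]//|ET] := pselect (E T).
  have approach (d : R) : 0 < d -> exists t, [/\ E t, t < T & T - t < d].
    move=> d0; have [t Et tT] := sup_adherent d0 Eb; exists t; split=> //.
      rewrite lt_neqAle; apply/andP; split; last exact: sup_upper_bound.
      by apply/eqP => tE; apply: ET; rewrite -tE.
    by rewrite ltrBlDr addrC -ltrBlDr.
  split.
    apply: accumulation_drazin_spectrum => d d0.
    have k1 : 0 < cnorm k + 1 by rewrite ltr_wpDl ?cnorm_ge0.
    have [t [[t1 [at_ bt]] tT Td]] := approach _ (divr_gt0 d0 k1).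
    have t0 : 0 < t by lra.
    exists (k / t%:C%C); split.
    - apply/eqP => /(mulfI k0) /invr_inj /(congr1 (@complex.Re R)) /= tE.
      by rewrite tE ltxx in tT.
    - by apply/negP => u; apply: at_; exists (a - (k / t%:C%C)%:A)^-1, 0%N;
        rewrite !expr0 !mul1r mulVr// mulrV// mul1r.
    - apply: le_lt_trans (dist _ _ _ _) _ => //.
      rewrite distrC gtr0_norm ?subr_gt0//.
      apply: le_lt_trans (_ : _ <= (cnorm k + 1) * (T - t)) _.
        by rewrite ler_wpM2r ?lerDl// subr_ge0 ltW.
      by rewrite mulrC -ltr_pdivlMr.
  apply: spectrum_closed => d d0.
  have l1 : 0 < cnorm l by rewrite cnorm_gt0.
  have [t [[t1 [at_ bt]] tT Td]] := approach _ (divr_gt0 d0 l1).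
  exists (l * t%:C%C) => //.
  rewrite -mulrBr -rmorphB /= cnormM cnormR distrC gtr0_norm ?subr_gt0//.
  by rewrite mulrC -ltr_pdivlMr.
have [t' Tt' Qt'] := Qopen T T1 QT.
have : t' <= T by apply: sup_upper_bound => //; split=> //; lra.
by rewrite leNgt Tt'.
Qed.

End TensorSpectrum.

(** * The Hahn-Banach theorem *)

Section HahnBanach.
Variables (R : realType) (V : normedModType R[i]).
Implicit Types (x y : V) (p q : V -> R).

Definition sublinear p : Prop :=
  [/\ forall x y, p (x + y) <= p x + p y,
      forall (t : R) x, 0 < t -> p (t%:C%C *: x) <= t * p x
    & forall x, p x <= rnorm x].

Lemma sublinear_rnorm : sublinear (@rnorm R V).
Proof.
split=> // [x y|t x t0]; first exact: ler_rnormD.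
by rewrite rnormZ cnormR gtr0_norm.
Qed.

Section Sublinear.
Variables (p : V -> R) (sp : sublinear p).

Lemma sublinear0 : p 0 = 0.
Proof.
case: sp => pD pZ _; have := pD 0 0; have := pZ 2^-1 0.
by rewrite scaler0 addr0 invr_gt0 ltr0n => /(_ isT); lra.
Qed.

Lemma sublinear_homog (t : R) x : 0 <= t -> p (t%:C%C *: x) = t * p x.
Proof.
case: sp => pD pZ _; rewrite le_eqVlt => /predU1P[<-|t0].
  by rewrite scale0r mul0r sublinear0.
apply/le_anti; rewrite pZ//= -ler_pdivlMl//.
have := pZ t^-1 (t%:C%C *: x); rewrite invr_gt0 => /(_ t0).
by rewrite scalerA -rmorphM /= mulVf ?gt_eqF// scale1r.
Qed.

Lemma sublinear_ge x : - p (- x) <= p x.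
Proof. by case: sp => pD _ _; have := pD x (- x); rewrite subrr sublinear0; lra. Qed.

(** Taking [t = 0] gives [perturb y <= p]; taking [t = 1] gives [perturb y x <= p (x + y) - p y],
    the reverse of subadditivity once [perturb y = p]. *)
Definition perturb y x := inf [set p (x + t%:C%C *: y) - t * p y | t in [set t | 0 <= t]].

Let perturb_lb y x (t : R) : 0 <= t -> - p (- x) <= p (x + t%:C%C *: y) - t * p y.
Proof.
case: sp => pD pZ _ t0; rewrite -sublinear_homog//.
by have := pD (- x) (x + t%:C%C *: y); rewrite addKr; lra.
Qed.

Lemma perturb_le y x (t : R) : 0 <= t -> perturb y x <= p (x + t%:C%C *: y) - t * p y.
Proof.
move=> t0; apply: ge_inf; last by exists t.
by exists (- p (- x)) => _ [s s0 <-]; exact: perturb_lb.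
Qed.

Lemma le_perturb y x (m : R) :
  (forall t, 0 <= t -> m <= p (x + t%:C%C *: y) - t * p y) -> m <= perturb y x.
Proof.
move=> H; apply: lb_le_inf; last by move=> _ [t t0 <-]; exact: H.
by exists (p (x + 0%:C%C *: y) - 0 * p y), 0 => /=.
Qed.

Lemma perturb_sublinear y : sublinear (perturb y).
Proof.
case: (sp) => pD pZ pn; split.
- move=> x x'; rewrite -lerBlDl; apply: le_perturb => t t0.
  rewrite lerBlDl -lerBlDr; apply: le_perturb => s s0.
  rewrite lerBlDr; apply: le_trans (perturb_le _ _ (addr_ge0 s0 t0)) _.
  have := pD (x + s%:C%C *: y) (x' + t%:C%C *: y).
  by rewrite addrACA -scalerDl -rmorphD /=; lra.
- move=> c x c0; rewrite mulrC -ler_pdivrMr//; apply: le_perturb => t t0.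
  rewrite ler_pdivrMr//.
  have ct : 0 <= c * t by rewrite mulr_ge0// ltW.
  apply: le_trans (perturb_le _ _ ct) _.
  rewrite rmorphM -scalerA -scalerDr.
  by have := pZ c (x + t%:C%C *: y) c0; lra.
- move=> x; apply: le_trans (perturb_le _ _ (lexx 0)) _.
  by rewrite scale0r addr0 mul0r subr0.
Qed.

End Sublinear.

(* A minimal sublinear functional is linear: perturbing it in a direction [y]
   gives a smaller one. *)
Lemma sublinear_minimal p : sublinear p -> exists2 f, sublinear f &
  (forall x, f x <= p x) /\
  (forall q, sublinear q -> (forall x, q x <= f x) -> q = f).
Proof.
move=> sp.
pose T := {q : V -> R | sublinear q /\ forall x, q x <= p x}.
(* The order is reversed, so that a maximal element for Zorn is a minimal functional and chains are
   bounded by pointwise infima. *)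
pose le_ (q r : T) := `[< forall x, sval r x <= sval q x >].
have [||||[f [sf fp]] fmin] := @Zorn T le_.
- by move=> q; apply/asboolP.
- move=> q r s /asboolP h1 /asboolP h2; apply/asboolP => x.
  exact: le_trans (h2 x) (h1 x).
- move=> [q sq] [r sr] /asboolP h1 /asboolP h2; apply: eq_exist.
  by apply/funext => x; apply/le_anti; rewrite h1 h2.
- move=> F Ftot; have [[q0 Fq0]|F0] := pselect (F !=set0); last first.
    by exists (exist _ p (conj sp (fun x => lexx _))) => q Fq; case: F0; exists q.
  pose g x := inf [set sval q x | q in F].
  have gne x : [set sval q x | q in F] !=set0 by exists (sval q0 x), q0.
  have g_le x (q : T) : F q -> g x <= sval q x.
    move=> Fq; apply: ge_inf; last by exists q.
    exists (- rnorm x) => _ [r Fr <-].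
    case: (svalP r) => sr _; apply: le_trans (sublinear_ge sr x).
    by rewrite lerN2; case: sr => _ _ /(_ (- x)); rewrite rnormN.
  have le_g x (m : R) : (forall q : T, F q -> m <= sval q x) -> m <= g x.
    by move=> H; apply: lb_le_inf => // _ [q Fq <-]; exact: H.
  have sg : sublinear g.
    split.
    + move=> x y; rewrite -lerBlDl; apply: (le_g) => q Fq.
      rewrite lerBlDl -lerBlDr; apply: (le_g) => r Fr; rewrite lerBlDr.
      have [/asboolP qr'|/asboolP rq'] := Ftot _ _ Fq Fr.
        case: (svalP r) => -[rD _ _] _.
        apply: le_trans (g_le _ _ Fr) _; apply: le_trans (rD _ _) _.
        by rewrite lerD2l.
      case: (svalP q) => -[qD _ _] _.
      apply: le_trans (g_le _ _ Fq) _; apply: le_trans (qD _ _) _.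
      by rewrite lerD2r.
    + move=> c x c0; rewrite mulrC -ler_pdivrMr//; apply: (le_g) => q Fq.
      rewrite ler_pdivrMr// mulrC; case: (svalP q) => -[_ qZ _] _.
      exact: le_trans (g_le _ _ Fq) (qZ _ _ c0).
    + move=> x; case: (svalP q0) => -[_ _ qn] _.
      exact: le_trans (g_le _ _ Fq0) (qn _).
  have gp x : g x <= p x.
    by case: (svalP q0) => _ qp; exact: le_trans (g_le _ _ Fq0) (qp _).
  exists (exist _ g (conj sg gp)) => q Fq; apply/asboolP => x /=; exact: g_le.
exists f => //; split=> // q sq qf.
have qp x : q x <= p x by exact: le_trans (qf x) (fp x).
suff /fmin /(congr1 sval) : le_ (exist _ f (conj sf fp)) (exist _ q (conj sq qp)) by [].
exact/asboolP.
Qed.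

(** Minimizing below the norm perturbed along [v], rather than below the norm, forces
    [f (- v) <= - rnorm v]. *)
Lemma real_functional v : exists f : V -> R,
  [/\ forall x y, f (x + y) = f x + f y,
      forall (t : R) x, f (t%:C%C *: x) = t * f x,
      forall x, f x <= rnorm x & f v = rnorm v].
Proof.
have [f sf [fp fmin]] := sublinear_minimal (perturb_sublinear sublinear_rnorm v).
have fD x y : f (x + y) = f x + f y.
  apply/le_anti; apply/andP; split; first by case: sf.
  have fy : perturb f y = f.
    apply: fmin (perturb_sublinear sf y) _ => z.
    apply: le_trans (perturb_le sf _ _ (lexx 0)) _.
    by rewrite scale0r addr0 mul0r subr0.
  have := perturb_le sf y x ler01; rewrite fy scale1r mul1r; lra.
have fN x : f (- x) = - f x.
  by apply/eqP; rewrite -addr_eq0 -fD addNr (sublinear0 sf).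
exists f; split=> //.
- move=> t x; have [t0|t0] := leP 0 t; first exact: sublinear_homog.
  have := sublinear_homog sf x (ltW (ltr_wpDl (lexx 0) (_ : 0 < - t))).
  by rewrite add0r oppr_gt0 => /(_ t0); rewrite rmorphN scaleNr fN mulNr => /oppr_inj.
- by case: sf.
apply/le_anti; apply/andP; split; first by case: sf.
have := fp (- v); rewrite fN => h.
have := perturb_le sublinear_rnorm v (- v) ler01.
by rewrite scale1r addNr rnorm0 mul1r sub0r; lra.
Qed.

Lemma norming_functional v : rnorm v = 1 -> exists phi : V -> R[i],
  [/\ forall x y, phi (x + y) = phi x + phi y,
      forall k x, phi (k *: x) = k * phi x,
      forall x, cnorm (phi x) <= rnorm x & phi v = 1].
Proof.
move=> v1; have [f [fD fZ fn fv]] := real_functional v.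
have fN x : f (- x) = - f x.
  by rewrite -scaleN1r -(rmorphN1 (real_complex R)) fZ mulN1r.
pose phi x : R[i] := (f x +i* - f ('i%C *: x))%C.
have phiD x y : phi (x + y) = phi x + phi y.
  by rewrite /phi scalerDr !fD opprD; simpc.
have phiZ k x : phi (k *: x) = k * phi x.
  case: k => u w; rewrite /phi.
  have -> : (u +i* w)%C = u%:C%C + w%:C%C * 'i%C by simpc.
  rewrite scalerDl -scalerA fD !fZ scalerDr fD.
  rewrite !(scalerA 'i%C) !(mulrC 'i%C) -!scalerA !fZ.
  have -> : 'i%C *: ('i%C *: x) = - x.
    by rewrite scalerA -expr2 sqr_i scaleN1r.
  rewrite fN; simpc; congr (_ +i* _)%C; ring.
have phin x : cnorm (phi x) <= rnorm x.
  have [->|px] := eqVneq (phi x) 0; first by rewrite cnorm0 rnorm_ge0.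
  pose k := (cnorm (phi x))%:C%C / phi x.
  have k1 : cnorm k = 1.
    rewrite /k cnormM cnormV cnormR ger0_norm ?cnorm_ge0// mulfV//.
    by rewrite gt_eqF// cnorm_gt0.
  have kx : phi (k *: x) = (cnorm (phi x))%:C%C by rewrite phiZ /k divfK.
  have -> : cnorm (phi x) = f (k *: x).
    by move/(congr1 (@complex.Re R)): kx.
  by apply: le_trans (fn _) _; rewrite rnormZ k1 mul1r.
exists phi; split=> //.
(* [phi v] has real part 1 and modulus at most 1, hence no imaginary part. *)
have := phin v; rewrite v1 /phi fv v1.
set w := f _; rewrite /cnorm normc_def /= expr1n sqrrN => h.
have : w ^+ 2 <= 0.
  rewrite -(@lerD2l _ 1) addr0 -(@ler_sqrt _ _ 1)// sqrtr1//.
by rewrite real_exprn_even_le0 ?num_real//= => /eqP ->; simpc.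
Qed.

End HahnBanach.

(** * Tensor products *)

Lemma exists_bilinear (K : comNzRingType) (U V W : lmodType K) (f : U -> V -> W) :
  (forall v, linear (f^~ v)) -> (forall u, linear (f u)) ->
  exists F : {bilinear U -> V -> W}, forall u v, F u v = f u v.
Proof.
move=> fl fr.
pose F : {bilinear U -> V -> W} := HB.pack f
  (bilinear_isBilinear.Build K U V W _ _ f (fl, fr)).
by exists F.
Qed.

Lemma exists_linear (K : comNzRingType) (U V : lmodType K) (f : U -> V) :
  linear f -> exists F : {linear U -> V}, F =1 f.
Proof.
move=> fl.
pose F : {linear U -> V} := HB.pack f (GRing.isLinear.Build K U V _ f fl).
by exists F.
Qed.

Section TensorProduct.
Variables (K : fieldType) (A B T : lmodType K) (t : {bilinear A -> B -> T}).
Hypothesis tP : is_tensor_product t.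

Lemma tensor_lift (W : lmodType K) (f : A -> B -> W) :
  (forall v, linear (f^~ v)) -> (forall u, linear (f u)) ->
  exists g : {linear T -> W}, forall x y, g (t x y) = f x y.
Proof.
move=> fl fr; have [F FE] := exists_bilinear fl fr.
by have [g gF _] := tP F; exists g => x y; rewrite gF FE.
Qed.

Lemma tensor_ext (W : lmodType K) (g h : T -> W) : linear g -> linear h ->
  (forall x y, g (t x y) = h (t x y)) -> g =1 h.
Proof.
move=> gl hl gh z.
have [G GE] := exists_linear gl; have [H HE] := exists_linear hl.
have ll v : linear (fun u => h (t u v)) by move=> k u u'; rewrite linearPl hl.
have lr u : linear (fun v => h (t u v)) by move=> k v v'; rewrite linearPr hl.
have [F FE] := exists_bilinear ll lr.
have [f _ fu] := tP F.
rewrite -GE -HE (fu G) ?(fu H)// => x y; rewrite ?GE ?HE FE//.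
Qed.

Lemma flip_tensor : exists t' : {bilinear B -> A -> T},
  (forall x y, t' y x = t x y) /\ is_tensor_product t'.
Proof.
have [||t' tE] := @exists_bilinear K B A T (fun y x => t x y).
- by move=> x k y y'; rewrite linearPr.
- by move=> y k x x'; rewrite linearPl.
exists t'; split=> // W f.
have ll v : linear (fun u => f v u) by move=> k u u'; rewrite linearPr.
have lr u : linear (fun v => f v u) by move=> k v v'; rewrite linearPl.
have [F FE] := exists_bilinear ll lr.
have [g gF gu] := tP F; exists g => [y x|g' g'f]; first by rewrite tE gF FE.
by apply: gu => x y; rewrite -tE g'f FE.
Qed.

End TensorProduct.

Section TensorSlices.
Variables (R : realType) (A B AB : banachAlgType R[i]) (T : normedModType R[i]).
Variables (t : {bilinear A -> B -> T}) (iota : {linear T -> AB}).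
Hypotheses (tP : is_tensor_product t) (tC : crossnorm t) (tU : uniform_norm t).
Hypothesis iotaP : is_completion iota.
Hypothesis iotaM : forall x x' y y',
  iota (t (x * x') (y * y')) = iota (t x y) * iota (t x' y').

Let al x := iota (t x 1).
Let be y := iota (t 1 y).

Lemma completion_approx (X : AB) (e : R) : 0 < e -> exists z, rnorm (iota z - X) < e.
Proof.
move=> e0; have eC : 0 < e%:C%C :> R[i] by rewrite ltcR.
have [_ /(_ (ball X e%:C%C))] := iotaP.
case=> [||y [/= Xz [z _ zy]]].
- by exists X; exact: ballxx.
- exact: ball_open.
by exists z; rewrite -ltcR -rnormE distrC zy; move: Xz; rewrite -ball_normE.
Qed.

Lemma rnorm_iota z : rnorm (iota z) = rnorm z.
Proof. by rewrite /rnorm iotaP.1. Qed.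

Lemma rnorm_tensor x y : rnorm (t x y) = rnorm x * rnorm y.
Proof. by rewrite /rnorm tC !rnormE -rmorphM. Qed.

(** Multiplicativity of [iota] makes this element a left unit for the range of [iota] only; density
    reaches the unit of [AB]. *)
Lemma tensor_one : iota (t 1 1) = 1.
Proof.
have lz z : iota (t 1 1) * iota z = iota z.
  apply: (tensor_ext tP (g := fun z => iota (t 1 1) * iota z) (h := iota)).
  - by move=> k u v; rewrite linearP mulrDr scalerAr.
  - by move=> k u v; rewrite linearP.
  - by move=> x y; rewrite -iotaM !mul1r.
rewrite -[LHS]mulr1; apply: eq_of_rnorm_small => e e0.
pose D := rnorm (iota (t 1 1)) + 1.
have D0 : 0 < D by rewrite ltr_wpDl ?rnorm_ge0.
have [z zP] := completion_approx 1 (divr_gt0 e0 D0).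
rewrite -(subrKA (iota z)) -{1}(lz z) -mulrBr.
apply: le_trans (ler_rnormD _ _) _.
apply: le_trans (_ : _ <= rnorm (iota (t 1 1)) * rnorm (iota z - 1)
   + rnorm (iota z - 1)) _.
  by apply: lerD => //; rewrite (rnormB (iota z)); exact: ler_rnormM.
by rewrite -[X in _ + X]mul1r -mulrDl mulrC -ler_pdivlMr// ltW.
Qed.

Lemma tensor_left_hom : algebra_hom al.
Proof.
split=> [x y|x y||k x]; rewrite /al.
- by rewrite linearDl linearD.
- by rewrite -iotaM mulr1.
- exact: tensor_one.
- by rewrite linearZl_LR linearZ.
Qed.

Lemma tensor_right_hom : algebra_hom be.
Proof.
split=> [x y|x y||k x]; rewrite /be.
- by rewrite linearDr linearD.
- by rewrite -iotaM mulr1.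
- exact: tensor_one.
- by rewrite linearZr_LR linearZ.
Qed.

Lemma tensor_split x y : iota (t x y) = al x * be y.
Proof. by rewrite /al /be -iotaM mulr1 mul1r. Qed.

Lemma tensor_comm x y : GRing.comm (al x) (be y).
Proof. by rewrite /GRing.comm /al /be -!iotaM !mulr1 !mul1r. Qed.

Lemma tensor_left_le x : rnorm (al x) = rnorm x * rnorm (1 : B).
Proof. by rewrite rnorm_iota rnorm_tensor. Qed.

Lemma tensor_right_le y : rnorm (be y) = rnorm (1 : A) * rnorm y.
Proof. by rewrite rnorm_iota rnorm_tensor. Qed.

Lemma opnorm_le1 (V : normedModType R[i]) (U : {linear V -> V}) :
  (forall x, rnorm (U x) <= rnorm x) -> 0 <= opnorm U <= 1.
Proof.
move=> U1; have ub : ubound [set complex.Re `|U x| | x in [set x : V | `|x| <= 1]] 1.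
  move=> _ [x /= x1 <-]; apply: le_trans (U1 x) _.
  by rewrite -lecR -rnormE.
have mem0 : [set complex.Re `|U x| | x in [set x : V | `|x| <= 1]] 0.
  by exists 0; rewrite /= ?normr0// linear0 normr0.
apply/andP; split; last by apply: ge_sup => //; exists 0.
by apply: sup_upper_bound => //; split; [exists 0|exists 1].
Qed.

(** The slice is contractive because [z |-> t (s z) v] is the tensor product of the identity with
    the rank-one operator [y |-> phi y *: v]. Uniformity bounds it by 1, and the crossnorm
    identifies the norm of [t (s z) v] with that of [s z]. *)
Lemma tensor_slice_map (v : B) : rnorm v = 1 -> exists (phi : B -> R[i]) (s : {linear T -> A}),
  [/\ phi v = 1, forall x y, s (t x y) = phi y *: x & forall z, rnorm (s z) <= rnorm z].
Proof.
move=> v1; have [phi [phiD phiZ phin phi1]] := norming_functional v1.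
have phiP k y y' : phi (k *: y + y') = k * phi y + phi y' by rewrite phiD phiZ.
have [||s sE] := tensor_lift tP (f := fun x y => phi y *: x).
- by move=> y k x x'; rewrite scalerDr !scalerA mulrC.
- by move=> x k y y'; rewrite phiP scalerDl scalerA.
have [U UE] : exists U : {linear A -> A}, U =1 id by apply: exists_linear.
have [V VE] : exists V : {linear B -> B}, V =1 (fun y => phi y *: v).
  by apply: exists_linear => k y y'; rewrite phiP scalerDl scalerA.
have [W WE] : exists W : {linear T -> T}, W =1 (fun z => t (s z) v).
  by apply: exists_linear => k z z'; rewrite linearP linearPl.
have U1 x : rnorm (U x) <= rnorm x by rewrite UE.
have V1 y : rnorm (V y) <= rnorm y by rewrite VE rnormZ v1 mulr1.
have bounded (X : normedModType R[i]) (F : {linear X -> X}) :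
    (forall x, rnorm (F x) <= rnorm x) -> bounded_linear F.
  by move=> F1; exists 1 => x; rewrite mul1r !rnormE lecR.
exists phi, s; split=> // z.
have Wt x y : W (t x y) = t (U x) (V y).
  by rewrite WE sE UE VE linearZl_LR linearZr_LR.
have := tU (bounded _ _ U1) (bounded _ _ V1) Wt z.
rewrite WE !rnormE rnorm_tensor v1 mulr1 -!rmorphM lecR => /le_trans; apply.
have /andP[u0 u1] := opnorm_le1 U1; have /andP[w0 w1] := opnorm_le1 V1.
rewrite -[leRHS]mul1r ler_wpM2r ?rnorm_ge0// -[leRHS]mul1r.
exact: ler_pM.
Qed.

Lemma tensor_slice (v : B) : rnorm v = 1 -> exists E, is_slice al be v E.
Proof.
move=> v1; have [phi [s [phi1 sE sn]]] := tensor_slice_map v1.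
(* The inequality for all [z] determines the value at [X] by density, and at once gives the
   Lipschitz bound and agreement with [s]. *)
have extend (X : AB) : exists l : A, forall z, rnorm (s z - l) <= rnorm (iota z - X).
  have /choice[u uP] (n : nat) : exists z, rnorm (iota z - X) <= n.+1%:R^-1.
    have [|z zX] := @completion_approx X n.+1%:R^-1; first by rewrite invr_gt0.
    by exists z; exact: ltW.
  have [|l lP] := @rcauchy_cvg R A (s \o u).
    move=> e e0; have [|N NP] := @invn_small R 1 (e / 2); first by rewrite divr_gt0.
    exists N => n m Nn Nm /=; rewrite -linearB /=; apply: le_trans (sn _) _.
    rewrite -rnorm_iota linearB /= (splitr e); apply: (@rnorm_trans _ _ X).
      by apply: le_trans (uP n) _; rewrite -[leLHS]mul1r NP.
    by rewrite rnormB; apply: le_trans (uP m) _; rewrite -[leLHS]mul1r NP.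
  exists l => z; apply/ler_addgt0Pr => e e0.
  have e20 : 0 < e / 2 by rewrite divr_gt0.
  have [N NP] := @invn_small R 1 _ e20; have [N' NP'] := lP _ e20.
  set n := maxn N N'.
  have un : rnorm (iota (u n) - X) <= e / 2.
    by apply: le_trans (uP n) _; rewrite -[leLHS]mul1r NP// leq_maxl.
  rewrite (splitr e) addrA; apply: (@rnorm_trans _ _ (s (u n))).
    rewrite -linearB; apply: le_trans (sn _) _; rewrite -rnorm_iota linearB.
    by apply: (@rnorm_trans _ _ X) => //; rewrite rnormB.
  by apply: NP'; exact: leq_maxr.
have /choice[E EP] := extend.
have Ei z : E (iota z) = s z.
  apply: eq_of_rnorm_small => e e0; rewrite rnormB; apply: le_trans (EP (iota z) z) _.
  by rewrite subrr rnorm0 ltW.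
have E_lip X Y : rnorm (E X - E Y) <= rnorm (X - Y).
  apply/ler_addgt0Pr => e e0; have e20 : 0 < e / 2 by rewrite divr_gt0.
  have [z zX] := completion_approx X e20.
  have h1 := EP X z; have h2 := EP Y z; rewrite rnormB in h1.
  have h3 := rnorm_trans h1 h2.
  have h4 := rnorm_trans (lexx (rnorm (iota z - X))) (lexx (rnorm (X - Y))).
  have h5 := splitr e; lra.
(* Every algebraic property of [E] is an equality of two Lipschitz maps, to be checked on the range
   of [iota] only. *)
have agree (F G : AB -> A) (M N : R) : 0 <= M -> 0 <= N ->
    (forall X Y, rnorm (F X - F Y) <= M * rnorm (X - Y)) ->
    (forall X Y, rnorm (G X - G Y) <= N * rnorm (X - Y)) ->
    (forall z, F (iota z) = G (iota z)) -> F =1 G.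
  move=> M0 N0 FM GN FG X; apply: eq_of_rnorm_small => e e0.
  have MN : 0 < M + N + 1 by rewrite ltr_wpDl// addr_ge0.
  have [z zX] := completion_approx X (divr_gt0 e0 MN).
  apply: le_trans (_ : _ <= (M + N) * rnorm (iota z - X)) _.
    rewrite mulrDl; apply: (@rnorm_trans _ _ (F (iota z))).
      by rewrite (rnormB (iota z)).
    by rewrite FG.
  apply: le_trans (_ : _ <= (M + N + 1) * rnorm (iota z - X)) _.
    by rewrite ler_wpM2r ?rnorm_ge0// lerDl.
  by rewrite mulrC -ler_pdivlMr// ltW.
exists E; split.
(* Additivity takes two density arguments, one for each variable. *)
- move=> X Y; have Ew w : (fun X => E (X + iota w)) =1 (fun X => E X + s w).
    apply: (agree _ _ 1 1) => // [X' Y'|X' Y'|z].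
    + by rewrite mul1r; apply: le_trans (E_lip _ _) _; rewrite opprD addrACA subrr addr0.
    + by rewrite mul1r opprD addrACA subrr addr0.
    + by rewrite -linearD !Ei linearD.
  have := agree (fun Y => E (X + Y)) (fun Y => E X + E Y) 1 1 ler01 ler01.
  apply=> [X' Y'|X' Y'|z].
  + by rewrite mul1r; apply: le_trans (E_lip _ _) _; rewrite opprD addrACA subrr add0r.
  + by rewrite mul1r opprD addrACA subrr add0r.
  + by rewrite Ew Ei.
- move=> k X; have := agree (fun X => E (k *: X)) (fun X => k *: E X) (cnorm k) (cnorm k)
    (cnorm_ge0 k) (cnorm_ge0 k).
  apply=> [X' Y'|X' Y'|z].
  + by apply: le_trans (E_lip _ _) _; rewrite -scalerBr rnormZ.
  + by rewrite -scalerBr rnormZ ler_wpM2l ?cnorm_ge0.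
  + by rewrite -linearZ !Ei linearZ.
- move=> X; have := E_lip X 0.
  have -> : E 0 = 0 by rewrite -(linear0 iota) Ei linear0.
  by rewrite !subr0.
- move=> x X.
  have [||L LE] := tensor_lift tP (f := fun x' y => t (x * x') y).
  + by move=> y k x1 x2; rewrite mulrDr -scalerAr linearPl.
  + by move=> x' k y1 y2; rewrite linearPr.
  have LA z : iota (L z) = al x * iota z.
    apply: (tensor_ext tP (g := fun z => iota (L z)) (h := fun z => al x * iota z)).
    * by move=> k z1 z2; rewrite !linearP.
    * by move=> k z1 z2; rewrite linearP mulrDr scalerAr.
    * by move=> x' y; rewrite LE -iotaM mul1r.
  have sL z : s (L z) = x * s z.
    apply: (tensor_ext tP (g := fun z => s (L z)) (h := fun z => x * s z)).
    * by move=> k z1 z2; rewrite !linearP.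
    * by move=> k z1 z2; rewrite linearP mulrDr scalerAr.
    * by move=> x' y; rewrite LE !sE scalerAr.
  have := agree (fun X => E (al x * X)) (fun X => x * E X) (rnorm (al x)) (rnorm x)
    (rnorm_ge0 _) (rnorm_ge0 _).
  apply=> [X' Y'|X' Y'|z].
  + by apply: le_trans (E_lip _ _) _; rewrite -mulrBr ler_rnormM.
  + by rewrite -mulrBr; apply: ler_rnormM2.
  + by rewrite -LA !Ei sL.
- move=> x X.
  have [||L LE] := tensor_lift tP (f := fun x' y => t (x' * x) y).
  + by move=> y k x1 x2; rewrite mulrDl -scalerAl linearPl.
  + by move=> x' k y1 y2; rewrite linearPr.
  have LA z : iota (L z) = iota z * al x.
    apply: (tensor_ext tP (g := fun z => iota (L z)) (h := fun z => iota z * al x)).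
    * by move=> k z1 z2; rewrite !linearP.
    * by move=> k z1 z2; rewrite linearP mulrDl scalerAl.
    * by move=> x' y; rewrite LE -iotaM mulr1.
  have sL z : s (L z) = s z * x.
    apply: (tensor_ext tP (g := fun z => s (L z)) (h := fun z => s z * x)).
    * by move=> k z1 z2; rewrite !linearP.
    * by move=> k z1 z2; rewrite linearP mulrDl scalerAl.
    * by move=> x' y; rewrite LE !sE scalerAl.
  have := agree (fun X => E (X * al x)) (fun X => E X * x) (rnorm (al x)) (rnorm x)
    (rnorm_ge0 _) (rnorm_ge0 _).
  apply=> [X' Y'|X' Y'|z].
  + by apply: le_trans (E_lip _ _) _; rewrite -mulrBl mulrC ler_rnormM.
  + by rewrite -mulrBl mulrC; apply: ler_rnormM2.
  + by rewrite -LA !Ei sL.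
- by rewrite /be Ei sE phi1 scale1r.
Qed.

End TensorSlices.

(** * Poles of the resolvent *)

Section PunctureNeighborhoods.
Variable R : realType.

Lemma nbhs_cnormP (l : (R[i] : numFieldType)) (P : set (R[i] : numFieldType)) :
  nbhs l P <-> exists2 d : R, 0 < d & forall k, cnorm (k - l) < d -> P k.
Proof.
split=> [/nbhs_ballP[e /= e0 eP]|[d d0 dP]].
  have e0' : 0 < complex.Re e by case: e e0 {eP} => u v; rewrite ltcE => /andP[].
  exists (complex.Re e) => // k kd; apply: eP; rewrite -ball_normE /= distrC cnormE.
  apply: lt_le_trans (_ : _ < (complex.Re e)%:C%C) _; first by rewrite ltcR.
  by rewrite RRe_real// gtr0_real.
apply/nbhs_ballP; exists d%:C%C; first by rewrite /= ltcR.
by move=> k; rewrite -ball_normE /= distrC cnormE ltcR => /dP.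
Qed.

Lemma dnbhs_cnormP (l : (R[i] : numFieldType)) (P : set (R[i] : numFieldType)) :
  (\forall k \near l^', P k) <->
  exists2 d : R, 0 < d & forall k, k != l -> cnorm (k - l) < d -> P k.
Proof.
rewrite /dnbhs; split=> [/nbhs_cnormP[d d0 dP]|[d d0 dP]].
  by exists d => // k kl kd; apply: dP.
by apply/nbhs_cnormP; exists d => // k kd kl; apply: dP.
Qed.

End PunctureNeighborhoods.

Section Coefficients.
Variables (R : realType) (V : normedModType R[i]).

Lemma small_real_exists (r : R) : 0 < r -> exists2 z : R[i], z != 0 & cnorm z < r.
Proof.
move=> r0; exists (r / 2)%:C%C; last by rewrite cnormR gtr0_norm ?divr_gt0//; lra.
apply/eqP => /(congr1 (@complex.Re R)) /=; lra.
Qed.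

Lemma rnorm_sum n (F : 'I_n -> V) : rnorm (\sum_(i < n) F i) <= \sum_(i < n) rnorm (F i).
Proof.
elim/big_rec2: _ => [|i e x _ xe]; first by rewrite rnorm0.
by apply: le_trans (ler_rnormD _ _) _; rewrite lerD2l.
Qed.

(** Uniqueness of Taylor coefficients up to an error of order [n]: let [z] tend to 0 for [d 0],
    divide by [z] and repeat. *)
Lemma coefficients_eq0 n (d : nat -> V) (K r : R) : 0 < r -> 0 <= K ->
  (forall z : R[i], z != 0 -> cnorm z < r ->
     rnorm (\sum_(i < n) z ^+ i *: d i) <= K * cnorm z ^+ n) ->
  forall i, (i < n)%N -> d i = 0.
Proof.
move=> r0 K0; elim: n d => [//|n IH] d dK.
pose L := K + \sum_(i < n) rnorm (d i.+1).
have L0 : 0 <= L by rewrite addr_ge0// sumr_ge0// => i _; exact: rnorm_ge0.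
have d0 : d 0%N = 0.
  apply: rnorm_small => e e0.
  pose s := Num.min r (Num.min 1 (e / (L + 1))).
  have L1 : 0 < L + 1 by rewrite ltr_wpDl.
  have s0 : 0 < s by rewrite !lt_min r0 ltr01 divr_gt0.
  have [z z0] := small_real_exists s0; rewrite !lt_min => /and3P[zr z1 ze].
  have := dK z z0 zr; rewrite big_ord_recl expr0 scale1r.
  set S := \sum_(i < n) _ => h.
  have SL : rnorm S <= cnorm z * \sum_(i < n) rnorm (d i.+1).
    rewrite /S; apply: le_trans (rnorm_sum _) _; rewrite mulr_sumr ler_sum// => i _.
    rewrite rnormZ ler_wpM2r ?rnorm_ge0// cnormX /= exprS ler_piMr ?cnorm_ge0//.
    by rewrite exprn_ile1 ?cnorm_ge0// ltW.
  have zn : K * cnorm z ^+ n.+1 <= cnorm z * K.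
    rewrite mulrC ler_wpM2r// exprS ler_piMr ?cnorm_ge0//.
    by rewrite exprn_ile1 ?cnorm_ge0// ltW.
  have := ler_rnormB (d 0%N + S) S; rewrite addrK => h2.
  apply: le_trans h2 _; apply: le_trans (_ : _ <= cnorm z * L) _.
    by rewrite /L mulrDr; apply: lerD => //; exact: le_trans h zn.
  apply: le_trans (_ : _ <= cnorm z * (L + 1)) _.
    by rewrite ler_wpM2l ?cnorm_ge0// lerDl.
  by rewrite -ler_pdivlMr// ltW.
case=> [//|i]; rewrite ltnS; apply: (IH (fun i => d i.+1)) => z z0 zr.
have z1 : 0 < cnorm z by rewrite cnorm_gt0.
have := dK z z0 zr; rewrite big_ord_recl d0 scaler0 add0r.
have -> : \sum_(i < n) z ^+ lift ord0 i *: d (lift ord0 i)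
    = z *: \sum_(i < n) z ^+ i *: d i.+1.
  by rewrite scaler_sumr; apply: eq_bigr => j _; rewrite scalerA -exprS.
by rewrite rnormZ exprS mulrCA ler_pM2l.
Qed.

Lemma series_terms_bounded (t : nat -> V) (u : V) : series t @ \oo --> u ->
  exists M : R, forall n, rnorm (t n) <= M.
Proof.
move=> /rcvgP /(_ 1 ltr01)[N NP].
have S0 : 0 <= \sum_(i < N) rnorm (t i) by rewrite sumr_ge0// => i _; exact: rnorm_ge0.
exists (2 + \sum_(i < N) rnorm (t i)) => n; have [Nn|nN] := leqP N n.
  have -> : t n = (series t n.+1 - u) - (series t n - u).
    by rewrite opprB addrA subrK seriesSr addrAC subrr add0r.
  apply: le_trans (ler_rnormB _ _) _.
  have := NP n Nn; have := NP n.+1 (leqW Nn); lra.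
rewrite (bigD1 (Ordinal nN))//= addrCA lerDl addr_ge0// sumr_ge0// => i _.
exact: rnorm_ge0.
Qed.

(** Convergence at [z0] bounds the terms there; halving the radius makes the ratio [q] at most 1/2,
    so the tail is at most twice its first term. *)
Lemma power_series_near0 (a : nat -> V) (z0 : R[i]) (u0 : V) : z0 != 0 ->
  series (fun n => z0 ^+ n *: a n) @ \oo --> u0 ->
  exists2 K : R, 0 <= K & forall z u, cnorm z <= cnorm z0 / 2 ->
    series (fun n => z ^+ n *: a n) @ \oo --> u -> rnorm (u - a 0%N) <= K * cnorm z.
Proof.
move=> z00 /series_terms_bounded[M MP].
have c0 : 0 < cnorm z0 by rewrite cnorm_gt0.
have M0 : 0 <= M by apply: le_trans (MP 0%N); exact: rnorm_ge0.
exists (2 * M / cnorm z0); first by rewrite !mulr_ge0// invr_ge0 ltW.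
move=> z u z2 zu; pose q := cnorm z / cnorm z0.
have q0 : 0 <= q by rewrite divr_ge0 ?cnorm_ge0.
have q2 : q <= 2^-1 by rewrite /q ler_pdivrMr// mulrC.
have aM n : rnorm (z ^+ n *: a n) <= M * q ^+ n.
  rewrite rnormZ cnormX /q expr_div_n mulrCA ler_wpM2l ?exprn_ge0 ?cnorm_ge0//.
  rewrite ler_pdivlMr ?exprn_gt0//.
  by have := MP n; rewrite rnormZ cnormX mulrC.
(* The extra summand [M * (2 * q ^+ n.+1)] is the room left for the remaining terms; it lets the
   induction close. *)
have SM n : rnorm (series (fun n => z ^+ n *: a n) n.+1 - a 0%N) + M * (2 * q ^+ n.+1)
    <= M * (2 * q).
  elim: n => [|n IH].
    by rewrite seriesSr seriesEnat /= big_geq// add0r expr0 scale1r subrr rnorm0 add0r expr1.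
  apply: le_trans IH; rewrite seriesSr [_ + z ^+ _ *: _]addrC -addrA.
  apply: le_trans (lerD (ler_rnormD _ _) (lexx _)) _.
  rewrite -addrA addrCA lerD2l.
  apply: le_trans (lerD (aM _) (lexx _)) _.
  rewrite -mulrDr ler_wpM2l// [q ^+ n.+2]exprS.
  have : q * q ^+ n.+1 <= 2^-1 * q ^+ n.+1 by rewrite ler_wpM2r// exprn_ge0.
  lra.
have -> : 2 * M / cnorm z0 * cnorm z = M * (2 * q) by rewrite /q; ring.
apply/ler_addgt0Pr => e e0.
have [N NP] := (rcvgP _ _).1 zu _ e0.
have h1 := NP N.+1 (leqnSn _); have h2 := SM N; rewrite rnormB in h1.
have h3 : 0 <= M * (2 * q ^+ N.+1) by rewrite !mulr_ge0// exprn_ge0.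
have := rnorm_trans h1 (lexx (rnorm (series (fun n => z ^+ n *: a n) N.+1 - a 0%N))).
lra.
Qed.

End Coefficients.

Section PolesAtZero.
Variables (R : realType) (A : banachAlgType R[i]).
Implicit Types (a : A) (z : R[i]).

Lemma spectrum0 a : spectrum a 0 <-> ~ (a \is a GRing.unit).
Proof.
rewrite /spectrum /= scale0r subr0.
by split=> [/negP|/negP].
Qed.

Lemma isolated_spectrum0 a : isolated (spectrum a) 0 <->
  ~ (a \is a GRing.unit) /\ exists2 d : R, 0 < d & forall z, z != 0 -> cnorm z < d ->
    a - z%:A \is a GRing.unit.
Proof.
split.
  move=> [/set_mem a0 [V /nbhs_cnormP[d d0 dV] Va]]; split; first exact/spectrum0.
  exists d => // z z0 zd; apply: contrapT => /negP az.
  have : (V `&` spectrum a) z by split=> //; apply: dV; rewrite subr0.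
  by rewrite Va /= => z00; rewrite z00 eqxx in z0.
move=> [a0 [d d0 dP]]; split; first by apply/mem_set/spectrum0.
exists [set z | cnorm z < d].
  by apply/nbhs_cnormP; exists d => // k; rewrite subr0.
apply/seteqP; split=> [z [/= zd /negP az]|_ ->].
  by apply: contrapT => /eqP z0; apply: az; exact: dP.
by split; [rewrite /= cnorm0|exact/spectrum0].
Qed.

Lemma invr_of_two_sided (x y : A) : x * y = 1 -> y * x = 1 -> x^-1 = y.
Proof.
move=> xy yx; have ux : x \is a GRing.unit by apply/unitrP; exists y.
by apply: (mulrI ux); rewrite mulrV.
Qed.

Lemma seriesE (u : nat -> A) n : series u n = \sum_(i < n) u i.
Proof. by rewrite seriesEnat /= big_mkord. Qed.

Lemma drazin_pole0 a : drazin_invertible a -> ~ (a \is a GRing.unit) -> poles a 0.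
Proof.
move=> aD aN; have [y [m ym]] := aD; split.
  by apply/isolated_spectrum0; split=> //; exact: drazin_punctured.
have := drazin_idemX ym; set e := 1 - a * y => em.
have e0 : e != 0.
  apply/eqP => e0; apply: aN; apply/unitrP; exists y.
  have ay : a * y = 1 by apply/eqP; rewrite eq_sym -subr_eq0 -/e e0.
  by split=> //; case: ym => _ _ <-.
(* The order of the pole is the nilpotency index of [a] on the corner of [e], which may be smaller
   than the exponent [m] of the given Drazin inverse. *)
have ex : exists n, a ^+ n * e == 0 by exists m; apply/eqP.
have q0 : a ^+ ex_minn ex * e = 0 by case: ex_minnP => n /eqP.
have qmin n : (n < ex_minn ex)%N -> a ^+ n * e != 0.
  by case: ex_minnP => k _ kmin nk; apply/negP => /kmin; rewrite leqNgt nk.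
move: (ex_minn ex) q0 qmin => q q0 qmin.
have q_gt0 : (0 < q)%N.
  by case: q q0 {qmin} => //; rewrite expr0 mul1r => /eqP; rewrite (negbTE e0).
have aq n : (q <= n)%N -> a ^+ n * e = 0.
  by move=> qn; rewrite -(subnK qn) exprD -mulrA q0 mulr0.
exists q => //; exists (fun n => - y ^+ n.+1), (fun n => a ^+ n.-1 * e); split.
- apply/dnbhs_cnormP; exists (rnorm y + 1)^-1.
    by rewrite invr_gt0 ltr_wpDl// rnorm_ge0.
  move=> z z0; rewrite subr0 => zd.
  have y1 : rnorm (z *: y) < 1.
    rewrite rnormZ; apply: le_lt_trans (_ : _ <= cnorm z * (rnorm y + 1)) _.
      by rewrite ler_wpM2l ?cnorm_ge0// lerDl.
    by rewrite -ltr_pdivlMr ?div1r// ltr_wpDl// rnorm_ge0.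
  have uy := unit_sub_small y1.
  have [GL GR] := drazin_shift_inverse ym z0 uy.
  set G := (X in _ * X = 1) in GL; rewrite -/G in GR.
  exists (- (y * (1 - z *: y)^-1)), (\sum_(k < m) z ^- k.+1 *: (a ^+ k * e)); split.
  + apply/rcvgP => d d0.
    pose C := rnorm (1 : A) * rnorm (y * (1 - z *: y)^-1).
    have [N NP] := geometric_small C (rnorm_ge0 _) y1 d0.
    exists N => n Nn; apply: le_trans (NP n Nn).
    have yz : GRing.comm y (z *: y) by rewrite /GRing.comm -scalerAr -scalerAl.
    have -> : series (fun n => z ^+ n *: - y ^+ n.+1) n
        = - (y * \sum_(i < n) (z *: y) ^+ i).
      rewrite seriesE mulr_sumr -sumrN; apply: eq_bigr => i _.
      by rewrite exprZn -scalerAr -exprS scalerN.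
    have -> : - (y * (\sum_(i < n) (z *: y) ^+ i)) - - (y / (1 - z *: y))
        = (z *: y) ^+ n * (y * (1 - z *: y)^-1).
      have S1 : \sum_(i < n) (z *: y) ^+ i = (1 - (z *: y) ^+ n) * (1 - z *: y)^-1.
        apply: (mulIr uy); rewrite -mulrA mulVr// mulr1.
        have -> : (1 - (z *: y) ^+ n) = (1 - z *: y) * \sum_(i < n) (z *: y) ^+ i.
          by apply: oppr_inj; rewrite -mulNr !opprB subrX1.
        apply: commr_sym; apply: commr_sum => i _; apply: commrX; apply: commr_sym.
        by apply: commrB; [exact: commr1|exact: commr_refl].
      rewrite S1 mulrBl mul1r mulrBr opprB -addrA subrr addr0 !mulrA.
      by rewrite (commrX n yz).
    apply: le_trans (ler_rnormM _ _) _; rewrite /C mulrAC.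
    by rewrite ler_wpM2r ?rnorm_ge0// ler_rnormX.
  + apply/rcvgP => d d0; exists (maxn m q) => n; rewrite geq_max => /andP[mn qn].
    rewrite seriesE -(subnKC mn) big_split_ord /= [X in _ + X - _]big1 ?addr0.
      by rewrite subrr rnorm0 ltW.
    move=> i _; have -> : a ^+ (m + i) * e = 0; last by rewrite scaler0.
    by rewrite addnC exprD -mulrA em mulr0.
  + rewrite /resolvent -opprB invrN (invr_of_two_sided GL GR) /G opprB addrC.
    by [].
- by apply: qmin; rewrite prednK.
- by move=> k qk; apply: aq; rewrite -ltnS prednK// (leq_trans _ qk).
Qed.

(** Multiplying the resolvent by [z ^+ p] and truncating after the constant Laurent coefficient
    gives a polynomial [P] with [(z - a) P(z) = z ^+ p] up to order [p.+1]. Comparing coefficients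
    shows that minus that constant coefficient solves both equations of [drazin_two_sided]. *)
Lemma pole0_drazin a : poles a 0 -> drazin_invertible a.
Proof.
move=> [/isolated_spectrum0[aN [d d0 dU]] [p p0 [ca [cb [L bp bP]]]]].
have [d' d'0 dL] := (dnbhs_cnormP _ _).1 L.
have {}dL z : z != 0 -> cnorm z < d' -> exists u v : A,
    [/\ series (fun n => z ^+ n *: ca n) @ \oo --> u,
        series (fun n => z ^- n.+1 *: cb n.+1) @ \oo --> v
      & resolvent a z = u + v].
  by move=> z0 zd; have := dL z z0; rewrite subr0 => /(_ zd).
pose r0 := Num.min d d'.
have r00 : 0 < r0 by rewrite lt_min d0.
have [z0 z00] := small_real_exists r00; rewrite lt_min => /andP[z0d z0d'].
have [u0 [_ [u0P _ _]]] := dL z0 z00 z0d'.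
have [K K0 KP] := power_series_near0 z00 u0P.
(* Coefficients of [z ^+ p] times the resolvent: the principal part in reverse order, then the
   constant term in degree [p]. *)
pose c i := if (i < p)%N then cb (p - i)%N else ca 0%N.
have cp : c p = ca 0%N by rewrite /c ltnn.
pose P (z : R[i]) := \sum_(i < p.+1) z ^+ i *: c i.
pose r := Num.min r0 (cnorm z0 / 2).
have r_gt0 : 0 < r by rewrite lt_min r00 divr_gt0// cnorm_gt0.
have key z : z != 0 -> cnorm z < r -> exists f : A,
    [/\ (z%:A - a) * f = 1, f * (z%:A - a) = 1
      & rnorm (P z - z ^+ p *: f) <= K * cnorm z ^+ p.+1].
  move=> zn0; rewrite /r /r0 !lt_min -andbA => /and3P[zd zd' zz0].
  have [u [v [uP vP f_uv]]] := dL z zn0 zd'.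
  have uz : z%:A - a \is a GRing.unit by rewrite -opprB unitrN; exact: dU.
  exists (resolvent a z); rewrite /resolvent mulrV// mulVr//; split=> //.
  rewrite -/(resolvent a z) f_uv.
  have vE : v = \sum_(i < p) z ^- i.+1 *: cb i.+1.
    apply: eq_of_rnorm_small => e e0; have [N NP] := (rcvgP _ _).1 vP e e0.
    have := NP (maxn N p) (leq_maxl _ _).
    rewrite seriesE -(subnKC (leq_maxr N p)) big_split_ord /= [X in _ + X - _]big1.
      by rewrite addr0 rnormB.
    by move=> i _; rewrite bP ?scaler0// ltnS leq_addr.
  have zv : z ^+ p *: v = \sum_(i < p) z ^+ i *: c i.
    rewrite vE scaler_sumr (reindex_inj rev_ord_inj); apply: eq_bigr => i _ /=.
    rewrite scalerA /c ltn_ord subnSK//; congr (_ *: _).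
    rewrite -[X in z ^+ X](subnK (ltnW (ltn_ord i))) addnC exprD -mulrA divff ?mulr1//.
    by rewrite expf_neq0.
  rewrite /P big_ord_recr /= cp scalerDr zv.
  have -> : forall s w : A, s + z ^+ p *: ca 0%N - (z ^+ p *: w + s)
      = - (z ^+ p *: (w - ca 0%N)).
    by move=> s w; rewrite scalerBr opprB (addrC s) opprD addrACA subrr addr0.
  rewrite rnormN rnormZ cnormX exprSr mulrCA ler_wpM2l ?exprn_ge0 ?cnorm_ge0//.
  by apply: KP uP; exact: ltW.
(* The coefficients of [z P(z)] up to degree [p]; its top term [z ^+ p.+1 *: c p] goes into the
   error. *)
pose c' i := if i is j.+1 then c j else 0.
have PL z : (z%:A - a) * P z - z ^+ p *: 1 =
    \sum_(i < p.+1) z ^+ i *: (c' i - a * c i - (if i == p :> nat then 1 else 0))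
    + z ^+ p.+1 *: c p.
  have zP : z *: P z = \sum_(i < p.+1) z ^+ i *: c' i + z ^+ p.+1 *: c p.
    transitivity (\sum_(i < p.+2) z ^+ i *: c' i); last by rewrite big_ord_recr.
    rewrite big_ord_recl scaler0 add0r scaler_sumr; apply: eq_bigr => i _.
    by rewrite scalerA -exprS.
  have aP : a * P z = \sum_(i < p.+1) z ^+ i *: (a * c i).
    by rewrite mulr_sumr; apply: eq_bigr => i _; rewrite scalerAr.
  have z1 : z ^+ p *: 1 = \sum_(i < p.+1) z ^+ i *: (if i == p :> nat then 1 else 0) :> A.
    rewrite big_ord_recr /= eqxx big1 ?add0r// => i _.
    by rewrite ltn_eqF// scaler0.
  rewrite mulrBl -scalerAl mul1r zP aP z1 -addrA addrAC [RHS]addrC addrA.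
  rewrite [RHS]addrC; congr (_ + _).
    rewrite -addrA -opprD -big_split -sumrB /=; apply: eq_bigr => i _.
    by rewrite !scalerBr opprD addrA.
have d_eq0 i : (i < p.+1)%N -> c' i - a * c i - (if i == p then 1 else 0) = 0.
  pose K' := (1 * rnorm (1 : A) + rnorm a) * K + rnorm (c p).
  apply: (@coefficients_eq0 R A p.+1
    (fun i => c' i - a * c i - (if i == p then 1 else 0)) K' (Num.min r 1)).
  - by rewrite lt_min r_gt0 ltr01.
  - by rewrite /K' addr_ge0 ?mulr_ge0 ?addr_ge0 ?mulr_ge0 ?rnorm_ge0.
  move=> z zn0; rewrite lt_min => /andP[zr z1].
  have [f [fl _ fP]] := key z zn0 zr.
  set S := (X in rnorm X); have -> : S = (z%:A - a) * (P z - z ^+ p *: f) - z ^+ p.+1 *: c p.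
    by rewrite mulrBr -scalerAr fl PL addrK.
  apply: le_trans (ler_rnormB _ _) _; rewrite /K' [leRHS]mulrDl; apply: lerD; last first.
    by rewrite rnormZ cnormX mulrC.
  rewrite -mulrA; apply: ler_rnormM2 => //.
  apply: le_trans (ler_rnormB _ _) _; rewrite lerD2r rnormZ.
  by rewrite ler_wpM2r ?rnorm_ge0// ltW.
have comm_eq0 i : (i < p.+1)%N -> a * c i - c i * a = 0.
  pose K' := rnorm a * K + rnorm a * K.
  apply: (@coefficients_eq0 R A p.+1 (fun i => a * c i - c i * a) K' r) => //.
  - by rewrite /K' addr_ge0 ?mulr_ge0 ?rnorm_ge0.
  move=> z zn0 zr; have [f [fl fr fP]] := key z zn0 zr.
  have fa : a * f = f * a.
    have := etrans fl (esym fr); rewrite mulrBl mulrBr -scalerAl -scalerAr mul1r mulr1.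
    by move=> /addrI /oppr_inj.
  have -> : \sum_(i < p.+1) z ^+ i *: (a * c i - c i * a)
      = a * (P z - z ^+ p *: f) - (P z - z ^+ p *: f) * a.
    rewrite mulrBr mulrBl -scalerAr -scalerAl fa opprB addrA subrK.
    rewrite mulr_sumr mulr_suml -sumrB; apply: eq_bigr => j _.
    by rewrite scalerBr scalerAr scalerAl.
  apply: le_trans (ler_rnormB _ _) _; rewrite /K' [leRHS]mulrDl; apply: lerD.
    by rewrite -mulrA; exact: ler_rnormM2.
  by rewrite -mulrA mulrC; exact: ler_rnormM2.
(* Below degree [p] the coefficient equations read [a * c 0 = 0] and [a * c k.+1 = c k]; in degree
   [p] they read [c p.-1 - a * c p = 1], and multiplying by [a ^+ p] leaves
   [- a ^+ p.+1 * c p = a ^+ p]. *)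
have ac k : (k < p)%N -> a ^+ k.+1 * c k = 0.
  elim: k => [_|k IH kp].
    have := d_eq0 0%N isT; rewrite /= eq_sym gtn_eqF// sub0r subr0 expr1.
    by move=> /eqP; rewrite oppr_eq0 => /eqP.
  have := d_eq0 k.+1 (ltnW kp); rewrite /= ltn_eqF// subr0 => /eqP.
  by rewrite subr_eq0 => /eqP cE; rewrite exprSr -mulrA -cE IH// ltnW.
have ap : a ^+ p.+1 * - c p = a ^+ p.
  have c'p : c' p = c p.-1 by rewrite -[in LHS](prednK p0).
  have acp : a ^+ p * c p.-1 = 0.
    by have := ac p.-1; rewrite prednK// => /(_ (leqnn _)).
  have /eqP := d_eq0 p (ltnSn _); rewrite eqxx c'p subr_eq0 => /eqP h.
  by rewrite -[RHS]mulr1 -h mulrBr acp sub0r mulrN mulrA -exprSr.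
apply: (@drazin_two_sided _ _ a (- c p) (- c p) p) => //.
rewrite -ap mulrN mulNr; congr (- _); apply: commrX.
by apply/eqP; rewrite -subr_eq0 -oppr_eq0 opprB; apply/eqP/comm_eq0.
Qed.

End PolesAtZero.

(** * Drazin invertibility of elementary tensors *)

Section DrazinFactors.
Variables (R : realType) (A : banachAlgType R[i]).
Implicit Types a x y : A.

Lemma unit_drazin x : x \is a GRing.unit -> drazin_invertible x.
Proof.
by move=> ux; exists x^-1, 0%N; rewrite !expr0 !mul1r mulVr// mulrV// mul1r.
Qed.

Lemma drazin_spectrum_sub x : drazin_spectrum x `<=` spectrum x.
Proof. by move=> l xl; apply/negP => /unit_drazin. Qed.

Lemma drazin_spectrum0 x : drazin_spectrum x 0 <-> ~ drazin_invertible x.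
Proof. by rewrite /drazin_spectrum /= scale0r subr0. Qed.

(** A nilpotent element has Drazin inverse 0. In the theorem, nonempty Drazin spectra thereby ensure
    that no power of [a] or [b] vanishes. *)
Lemma nilpotent_drazin_spectrum x n : x ^+ n = 0 -> drazin_spectrum x = set0.
Proof.
move=> xn; have x0 : drazin_inverse x 0 n.
  by split; rewrite ?xn ?mulr0 ?mul0r.
apply/seteqP; split=> // l; have [->|l0] := eqVneq l 0.
  by move=> /drazin_spectrum0; apply; exists 0, n.
apply; apply: unit_drazin.
have [|GL GR] := drazin_shift_inverse x0 l0; first by rewrite scaler0 subr0 unitr1.
by apply/unitrP; eexists; split; [exact: GR|exact: GL].
Qed.

End DrazinFactors.

Section TensorFactors.
Variables (R : realType) (A B C : banachAlgType R[i]).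
Variables (al : A -> C) (be : B -> C).
Hypotheses (alh : algebra_hom al) (beh : algebra_hom be).
Hypothesis ab_comm : forall x y, GRing.comm (al x) (be y).

Lemma tensor_exp a b n : (al a * be b) ^+ n = al (a ^+ n) * be (b ^+ n).
Proof. by rewrite exprMn_comm// (hom_exp alh) (hom_exp beh). Qed.

Lemma drazin_tensor a b : drazin_invertible a -> drazin_invertible b ->
  drazin_invertible (al a * be b).
Proof.
move=> [x [m ax]] [y [n by_]].
have raise (D : banachAlgType R[i]) (u v : D) p q : drazin_inverse u v p ->
    u ^+ (p + q).+1 * v = u ^+ (p + q) /\ v * u ^+ (p + q).+1 = u ^+ (p + q).
  move=> uv; split.
    by rewrite -addSn addnC exprD -mulrA (drazin_powr uv) -exprD addnC.
  by rewrite -addSn exprD mulrA (drazin_powl uv) -exprD.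
have [ax1 ax2] := raise _ _ _ _ n ax; have [by1 by2] := raise _ _ _ _ m by_.
rewrite (addnC n) in by1 by2.
apply: (@drazin_two_sided _ _ _ (al x * be y) (al x * be y) (m + n)).
- rewrite !tensor_exp mulrA -(mulrA (al _)) -ab_comm !mulrA -(hom_mul alh) ax1.
  by rewrite -mulrA -(hom_mul beh) by1.
- rewrite !tensor_exp mulrA -(mulrA (al _)) -ab_comm !mulrA -(hom_mul alh) ax2.
  by rewrite -mulrA -(hom_mul beh) by2.
Qed.

Hypothesis slices : forall v, rnorm v = 1 -> exists E, is_slice al be v E.

(** Slicing at the normalized power [b ^+ m], with [m] the exponent of the Drazin inverse of the
    product, sends [(al a * be b) ^+ m] to a multiple of [a ^+ m]. The one-sided equations of the
    product then slice to those of [a]. *)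
Lemma drazin_left_factor a b : (forall n, b ^+ n != 0) ->
  drazin_invertible (al a * be b) -> drazin_invertible a.
Proof.
move=> b0 [y [m zy]].
have bm : 0 < rnorm (b ^+ m) by exact: rnorm_gt0.
pose s : R[i] := (rnorm (b ^+ m))^-1%:C%C.
have [|E sE] := slices (v := s *: b ^+ m).
  by rewrite rnormZ cnorm_real ?invr_ge0 ?ltW// mulVf// gt_eqF.
have E1 : s *: E (be (b ^+ m)) = 1.
  by rewrite -(slice_scale sE) -(hom_scale beh) (slice_one sE).
have Ez : s *: E ((al a * be b) ^+ m) = a ^+ m.
  by rewrite tensor_exp (slice_mull sE) scalerAr E1 mulr1.
apply: (@drazin_two_sided _ _ a (s *: E (be (b ^+ m.+1) * y))
    (s *: E (y * be (b ^+ m.+1))) m).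
  rewrite -scalerAr -(slice_mull sE) mulrA -tensor_exp (drazin_powr zy).
  exact: Ez.
rewrite -scalerAl -(slice_mulr sE) -mulrA -ab_comm -tensor_exp (drazin_powl zy).
exact: Ez.
Qed.

Lemma tensor_drazin_spectrum_sub a b l : drazin_spectrum (al a * be b) l ->
  (set_mul (spectrum a) (drazin_spectrum b)
     `|` set_mul (drazin_spectrum a) (spectrum b)) l.
Proof.
move=> lz; apply: contrapT => lD; apply: lz.
apply: drazin_mul_shift => // k k' ak bk kk'.
have hom_spectrum (D : banachAlgType R[i]) (f : D -> C) x h : algebra_hom f ->
    spectrum (f x) h -> spectrum x h.
  move=> fh /negP fx; apply/negP => /(hom_unit fh).
  by rewrite hom_sub// hom_alg.
have {}ak := hom_spectrum _ _ _ _ alh ak; have {}bk := hom_spectrum _ _ _ _ beh bk.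
split.
- rewrite -(hom_alg alh) -(hom_sub alh); apply: (hom_drazin alh).
  by apply: contrapT => ak'; apply: lD; right; exists k => //; exists k'.
- rewrite -(hom_alg beh) -(hom_sub beh); apply: (hom_drazin beh).
  by apply: contrapT => bk'; apply: lD; left; exists k => //; exists k'.
Qed.

End TensorFactors.

(** * Equivalence of the three conditions *)

Unset Implicit Arguments.
Set Strict Implicit.
Set Printing Implicit Defensive.

Theorem theorem4p3 (R : realType) (A B : banachAlgType R[i])
    (T : normedModType R[i]) (tens : {bilinear A -> B -> T})
    (AB : banachAlgType R[i]) (iota : {linear T -> AB}) (a : A) (b : B) :
  is_tensor_product tens ->
  crossnorm tens ->
  uniform_norm tens ->
  is_completion iota ->
  (forall x x' y y', iota (tens (x * x') (y * y'))
                     = iota (tens x y) * iota (tens x' y')) ->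
  drazin_spectrum a !=set0 ->
  drazin_spectrum b !=set0 ->
  let ab : AB := iota (tens a b) in
  let D := set_mul (spectrum a) (drazin_spectrum b)
           `|` set_mul (drazin_spectrum a) (spectrum b) in
  let i := D = drazin_spectrum ab in
  let ii := (a \is a GRing.unit /\ b \is a GRing.unit)
            \/ ~ drazin_invertible ab in
  let iii := (a \is a GRing.unit /\ b \is a GRing.unit)
             \/ ~ ((poles a `&` drazin_resolvent_set b)
                   `|` (drazin_resolvent_set a `&` poles b)) 0 in
  (i <-> ii) /\ (ii <-> iii).
Proof.
move=> tP tC tU iP iM [ka ka_a] [lb lb_b] ab D i ii iii.
pose al (x : A) : AB := iota (tens x 1); pose be (y : B) : AB := iota (tens 1 y).
have alh : algebra_hom al := tensor_left_hom tP iP iM.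
have beh : algebra_hom be := tensor_right_hom tP iP iM.
have ab_comm x y : GRing.comm (al x) (be y) := tensor_comm iM x y.
have ba_comm y x : GRing.comm (be y) (al x) by exact: commr_sym.
have abE : ab = al a * be b := tensor_split iM a b.
have slicesA v : rnorm v = 1 -> exists E, is_slice al be v E.
  exact: tensor_slice tP tC tU iP iM v.
have slicesB v : rnorm v = 1 -> exists E, is_slice be al v E.
  (* Slices onto the other factor come from the flipped tensor product, which has the same crossnorm
     and uniformity properties. *)
  have [tens' [tE tP']] := flip_tensor tP.
  have tC' : crossnorm tens' by move=> y x; rewrite tE tC mulrC.
  have tU' : uniform_norm tens'.
    move=> U V W bU bV WE z; rewrite [X in _ <= X * _]mulrC.
    by apply: tU => // x y; rewrite -!tE.
  have iM' y y' x x' : iota (tens' (y * y') (x * x'))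
      = iota (tens' y x) * iota (tens' y' x') by rewrite !tE.
  have alE : al = fun x => iota (tens' 1 x) by apply/funext => x; rewrite tE.
  have beE : be = fun y => iota (tens' y 1) by apply/funext => y; rewrite tE.
  by rewrite alE beE; exact: tensor_slice tP' tC' tU' iP iM' v.
pose N := rnorm (1 : A) + rnorm (1 : B).
have al_le x : rnorm (al x) <= N * rnorm x.
  by rewrite tensor_left_le// mulrC ler_wpM2r ?rnorm_ge0// lerDr rnorm_ge0.
have be_le y : rnorm (be y) <= N * rnorm y.
  by rewrite tensor_right_le// ler_wpM2r ?rnorm_ge0// lerDl rnorm_ge0.
have not_nil (F : banachAlgType R[i]) (x : F) l n : drazin_spectrum x l -> x ^+ n != 0.
  by move=> xl; apply/eqP => /nilpotent_drazin_spectrum x0; rewrite x0 in xl.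
have sub_D : drazin_spectrum ab `<=` D.
  by move=> l; rewrite abE; exact: tensor_drazin_spectrum_sub.
have D_sub l : l != 0 -> D l -> drazin_spectrum ab l.
  move=> l0 [[k ak [k' bk kk']]|[k ak [k' bk kk']]]; rewrite abE -kk' in l0 *.
    rewrite ab_comm mulrC.
    apply: (product_drazin_spectrum beh alh ba_comm be_le al_le slicesB slicesA _ bk ak).
    by rewrite mulrC.
  exact: (product_drazin_spectrum alh beh ab_comm al_le be_le slicesA slicesB l0 ak bk).
have D0 : D 0 <-> ~ (a \is a GRing.unit /\ b \is a GRing.unit).
  split=> [D0 [ua ub]|].
    have nz (F : banachAlgType R[i]) (x : F) k : x \is a GRing.unit -> spectrum x k -> k != 0.
      by move=> ux xk; apply/eqP => k0; move: xk; rewrite k0 => /spectrum0.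
    case: D0 => -[k ak [k' bk kk']].
      have := mulf_neq0 (nz _ _ _ ua ak) (nz _ _ _ ub (drazin_spectrum_sub bk)).
      by rewrite kk' eqxx.
    have := mulf_neq0 (nz _ _ _ ua (drazin_spectrum_sub ak)) (nz _ _ _ ub bk).
    by rewrite kk' eqxx.
  (* A spectral value 0 of one factor gives a point of [D] only when multiplied by some point of the
     Drazin spectrum of the other: here [lb] and [ka] are needed. *)
  move=> /not_andP[ua|ub].
    by left; exists 0; [exact/spectrum0|exists lb; rewrite ?mul0r].
  by right; exists ka => //; exists 0; [exact/spectrum0|rewrite mulr0].
split.
  split=> [iE|iiP].
    have [u|u] := pselect (a \is a GRing.unit /\ b \is a GRing.unit); [by left|right].
    by apply/drazin_spectrum0; rewrite -iE; exact/D0.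
  apply/seteqP; split=> // l Dl; have [l0|l0] := eqVneq l 0; last exact: D_sub.
  move: Dl; rewrite l0 => /D0 uN; apply/drazin_spectrum0.
  by case: iiP.
have [u|uN] := pselect (a \is a GRing.unit /\ b \is a GRing.unit).
  by split=> _; left.
have drazin_ab : drazin_invertible ab <-> drazin_invertible a /\ drazin_invertible b.
  rewrite abE; split=> [z|[aD bD]]; last exact: drazin_tensor.
  split.
    apply: (drazin_left_factor alh beh ab_comm slicesA _ z) => n.
    exact: not_nil lb_b.
  rewrite ab_comm in z.
  apply: (drazin_left_factor beh alh ba_comm slicesB _ z) => n.
  exact: not_nil ka_a.
have resolvent0 (F : banachAlgType R[i]) (x : F) :
    drazin_resolvent_set x 0 <-> drazin_invertible x.
  split=> [xN|xD]; last by move=> /drazin_spectrum0.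
  by apply: contrapT => /drazin_spectrum0.
have polesE : ((poles a `&` drazin_resolvent_set b)
    `|` (drazin_resolvent_set a `&` poles b)) 0 <-> drazin_invertible ab.
  rewrite drazin_ab; split=> [[[pa /resolvent0 bD]|[/resolvent0 aD pb]]|[aD bD]].
  - by split=> //; exact: pole0_drazin.
  - by split=> //; exact: pole0_drazin.
  - case/not_andP: uN => [ua|ub].
      by left; split; [exact: drazin_pole0|exact/resolvent0].
    by right; split; [exact/resolvent0|exact: drazin_pole0].
by split=> -[//|H]; right => h; apply: H; apply/polesE.
Qed.
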